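(* Suppose that $\kappa_2\not\equiv\kappa_1-1\pmod e$ and $n\equiv\kappa_2-\kappa_1+1\pmod e$. Then $\operatorname{im}(\gamma_m)$ is an irreducible $\mathscr H_n^\Lambda$-module for all $m\in\{0,\dots,n-1\}$.
   Context: Let $\mathbb F$ be a field, $e\geqslant 3$ an integer, $I=\mathbb Z/e\mathbb Z$, $n\geqslant 1$ an integer and $\kappa=(\kappa_1,\kappa_2)\in I^2$. For $i,j\in I$ write $i\to j$ if $j=i+1$ and $i\leftarrow j$ if $j=i-1$. The symmetric group $\mathfrak S_n$, with $s_r=(r,r+1)$, acts on $I^n$ by place permutations. Algebra. $\mathscr H_n$ is the unital associative $\mathbb F$-algebra with generators $e(\mathbf i)$ ($\mathbf i\in I^n$), $y_1,\dots,y_n$, $\psi_1,\dots,\psi_{n-1}$ and relations: $e(\mathbf i)e(\mathbf j)=\delta_{\mathbf i,\mathbf j}e(\mathbf i)$; $\sum_{\mathbf i}e(\mathbf i)=1$; $y_re(\mathbf i)=e(\mathbf i)y_r$; $\psi_re(\mathbf i)=e(s_r\mathbf i)\psi_r$; $y_ry_s=y_sy_r$; $\psi_ry_s=y_s\psi_r$ if $s\ne r,r+1$; $\psi_r\psi_s=\psi_s\psi_r$ if $|r-s|>1$; $\psi_ry_{r+1}e(\mathbf i)=(y_r\psi_r+\delta_{i_r,i_{r+1}})e(\mathbf i)$; $y_{r+1}\psi_re(\mathbf i)=(\psi_ry_r+\delta_{i_r,i_{r+1}})e(\mathbf i)$; $\psi_r^2e(\mathbf i)$ equals $0$ if $i_r=i_{r+1}$,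 $(y_{r+1}-y_r)e(\mathbf i)$ if $i_r\to i_{r+1}$, $(y_r-y_{r+1})e(\mathbf i)$ if $i_r\leftarrow i_{r+1}$, and $e(\mathbf i)$ otherwise; $\psi_r\psi_{r+1}\psi_re(\mathbf i)$ equals $(\psi_{r+1}\psi_r\psi_{r+1}+1)e(\mathbf i)$ if $i_{r+2}=i_r\to i_{r+1}$, $(\psi_{r+1}\psi_r\psi_{r+1}-1)e(\mathbf i)$ if $i_{r+2}=i_r\leftarrow i_{r+1}$, and $\psi_{r+1}\psi_r\psi_{r+1}e(\mathbf i)$ otherwise. The cyclotomic algebra $\mathscr H_n^\Lambda$ (level 2) is the quotient of $\mathscr H_n$ by the relations $y_1^{c(i_1)}e(\mathbf i)=0$ for all $\mathbf i\in I^n$, where $c(i)=\#\{j\in\{1,2\}:\kappa_j=i\}$. Specht modules labelled by hook bipartitions. For $0\leqslant m\leqslant n$ put $\mathbf i_{((n-m),(1^m))}=(\kappa_2,\kappa_2-1,\dots,\kappa_2-m+1,\kappa_1,\kappa_1+1,\dots,\kappa_1+n-m-1)\in I^n$. The Specht module $S_{((n-m),(1^m))}$ is the module generated by $z=z_{((n-m),(1^m))}$ subject only to $e(\mathbf i_{((n-m),(1^m))})z=z$, $y_rz=0$ for $1\leqslant r\leqslant n$, and $\psi_rz=0$ for all $r\in\{1,\dots,n-1\}\setminus\{m\}$; it is an $\mathscr H_n^\Lambda$-module. For $1\leqslant a_1<\dots<a_m\leqslant n$ define $v(a_1,\dots,a_m)=(\psi_{a_1-1}\cdots\psi_1)(\psi_{a_2-1}\cdots\psi_2)\cdots(\psi_{a_m-1}\cdots\psi_m)z$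 (indices decreasing in each factor; the factor is $1$ if $a_j=j$). These vectors form an $\mathbb F$-basis (the standard basis) of $S_{((n-m),(1^m))}$. Homomorphism. When $n\equiv\kappa_2-\kappa_1+1\pmod e$ and $0\leqslant m\leqslant n-1$, $\gamma_m:S_{((n-m),(1^m))}\to S_{((n-m-1),(1^{m+1}))}$ is the (well-defined) $\mathscr H_n^\Lambda$-homomorphism with $\gamma_m(z_{((n-m),(1^m))})=v(1,\dots,m,n)$. *)

(* Defs.v *)
From HB Require Import structures.
From mathcomp Require Import all_boot all_order all_algebra.
From mathcomp Require Import boolp ring zify.
From mathcomp Require Import monalg.

Set Implicit Arguments.
Unset Strict Implicit.
Unset Printing Implicit Defensive.

Import GRing.Theory.

Local Open Scope ring_scope.
Local Open Scope quotient_scope.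

Section RingQuotient.
Variables (R : pzRingType) (rel : R -> R -> Prop).

Inductive ideal_gen : R -> Prop :=
| ideal_gen_rel x y of rel x y : ideal_gen (x - y)
| ideal_gen0 : ideal_gen 0
| ideal_genD x y of ideal_gen x & ideal_gen y : ideal_gen (x + y)
| ideal_genMl a x of ideal_gen x : ideal_gen (a * x)
| ideal_genMr a x of ideal_gen x : ideal_gen (x * a).

Definition ideal_pred : {pred R} := fun x => `[< ideal_gen x >].

Fact ideal_zmod_closed : zmod_closed ideal_pred.
Proof.
split=> [|x y]; rewrite !unfold_in; first exact/asboolP/ideal_gen0.
move=> /asboolP hx /asboolP hy; apply/asboolP; rewrite -mulN1r.
by apply: ideal_genD => //; apply: ideal_genMl.
Qed.

HB.instance Definition _ := GRing.isZmodClosed.Build R ideal_pred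
  ideal_zmod_closed.

Definition ring_quot := Quotient.quot ideal_pred.

HB.instance Definition _ := Choice.on ring_quot.
HB.instance Definition _ := GRing.Zmodule.on ring_quot.
HB.instance Definition _ := EqQuotient.on ring_quot.

Definition ring_proj (x : R) : ring_quot := \pi x.

Lemma ring_projP x y : ring_proj x = ring_proj y <-> ideal_gen (x - y).
Proof.
split=> [/eqP|h]; first by rewrite -Quotient.idealrBE => /asboolP.
by apply/eqP; rewrite -Quotient.idealrBE; apply/asboolP.
Qed.

Lemma ring_projK (q : ring_quot) : ring_proj (repr q) = q.
Proof. exact: reprK. Qed.

Fact ring_projB : zmod_morphism ring_proj.
Proof. by move=> x y; rewrite /ring_proj !piE. Qed.

HB.instance Definition _ :=
  GRing.isZmodMorphism.Build R ring_quot ring_proj ring_projB.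

Definition ring_quot_mul (p q : ring_quot) := ring_proj (repr p * repr q).

Fact ring_projM x y :
  ring_proj (x * y) = ring_quot_mul (ring_proj x) (ring_proj y).
Proof.
apply/ring_projP; set x' := repr _; set y' := repr _.
have -> : x * y - x' * y' = (x - x') * y + x' * (y - y').
  by rewrite mulrBl mulrBr addrA subrK.
by apply: ideal_genD; [apply: ideal_genMr | apply: ideal_genMl];
  apply/ring_projP; rewrite ring_projK.
Qed.

Fact ring_quot_mulA : associative ring_quot_mul.
Proof.
by move=> p q r; rewrite -[p]ring_projK -[q]ring_projK -[r]ring_projK
  -!ring_projM mulrA.
Qed.

Fact ring_quot_mul1r : left_id (ring_proj 1) ring_quot_mul.
Proof. by move=> p; rewrite -[p]ring_projK -ring_projM mul1r. Qed.

Fact ring_quot_mulr1 : right_id (ring_proj 1) ring_quot_mul.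
Proof. by move=> p; rewrite -[p]ring_projK -ring_projM mulr1. Qed.

Fact ring_quot_mulDl : left_distributive ring_quot_mul +%R.
Proof.
by move=> p q r; rewrite -[p]ring_projK -[q]ring_projK -[r]ring_projK
  -raddfD -!ring_projM mulrDl raddfD.
Qed.

Fact ring_quot_mulDr : right_distributive ring_quot_mul +%R.
Proof.
by move=> p q r; rewrite -[p]ring_projK -[q]ring_projK -[r]ring_projK
  -raddfD -!ring_projM mulrDr raddfD.
Qed.

HB.instance Definition _ := GRing.Zmodule_isPzRing.Build ring_quot
  ring_quot_mulA ring_quot_mul1r ring_quot_mulr1
  ring_quot_mulDl ring_quot_mulDr.

Fact ring_proj_monoid_morphism : monoid_morphism ring_proj.
Proof. by split=> // x y; rewrite ring_projM. Qed.

HB.instance Definition _ := GRing.isMonoidMorphism.Build R ring_quot ring_proj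
  ring_proj_monoid_morphism.

End RingQuotient.

Section CyclicModule.
Variables (A : pzRingType) (rel : A -> Prop).

Inductive left_ideal_gen : A -> Prop :=
| left_ideal_gen_rel x of rel x : left_ideal_gen x
| left_ideal_gen0 : left_ideal_gen 0
| left_ideal_genD x y of left_ideal_gen x & left_ideal_gen y :
    left_ideal_gen (x + y)
| left_ideal_genM a x of left_ideal_gen x : left_ideal_gen (a * x).

Definition left_ideal_pred : {pred A} := fun x => `[< left_ideal_gen x >].

Fact left_ideal_zmod_closed : zmod_closed left_ideal_pred.
Proof.
split=> [|x y]; rewrite !unfold_in; first exact/asboolP/left_ideal_gen0.
move=> /asboolP hx /asboolP hy; apply/asboolP; rewrite -mulN1r.
by apply: left_ideal_genD => //; apply: left_ideal_genM.
Qed.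

HB.instance Definition _ := GRing.isZmodClosed.Build A left_ideal_pred
  left_ideal_zmod_closed.

(* The left [A]-module on one generator [cyclic_gen] subject only to the
   relations [x *: cyclic_gen = 0] for [rel x]. *)
Definition cyclic_module := Quotient.quot left_ideal_pred.

HB.instance Definition _ := Choice.on cyclic_module.
HB.instance Definition _ := GRing.Zmodule.on cyclic_module.
HB.instance Definition _ := EqQuotient.on cyclic_module.

Definition cyclic_proj (x : A) : cyclic_module := \pi x.

Lemma cyclic_projP x y : cyclic_proj x = cyclic_proj y <-> left_ideal_gen (x - y).
Proof.
split=> [/eqP|h]; first by rewrite -Quotient.idealrBE => /asboolP.
by apply/eqP; rewrite -Quotient.idealrBE; apply/asboolP.
Qed.

Lemma cyclic_projK (q : cyclic_module) : cyclic_proj (repr q) = q.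
Proof. exact: reprK. Qed.

Fact cyclic_projB : zmod_morphism cyclic_proj.
Proof. by move=> x y; rewrite /cyclic_proj !piE. Qed.

HB.instance Definition _ :=
  GRing.isZmodMorphism.Build A cyclic_module cyclic_proj cyclic_projB.

Definition cyclic_scale (a : A) (q : cyclic_module) := cyclic_proj (a * repr q).

Fact cyclic_projM a x : cyclic_proj (a * x) = cyclic_scale a (cyclic_proj x).
Proof.
apply/cyclic_projP; rewrite -mulrBr; apply: left_ideal_genM.
by apply/cyclic_projP; rewrite cyclic_projK.
Qed.

Fact cyclic_scaleA a b q :
  cyclic_scale a (cyclic_scale b q) = cyclic_scale (a * b) q.
Proof. by rewrite -[q]cyclic_projK -!cyclic_projM mulrA. Qed.

Fact cyclic_scale1 : left_id 1 cyclic_scale.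
Proof. by move=> q; rewrite -[q]cyclic_projK -cyclic_projM mul1r. Qed.

Fact cyclic_scaleDr : right_distributive cyclic_scale +%R.
Proof.
move=> a p q; rewrite -[p]cyclic_projK -[q]cyclic_projK.
by rewrite -raddfD -!cyclic_projM mulrDr raddfD.
Qed.

Fact cyclic_scaleDl q : {morph cyclic_scale^~ q : a b / a + b}.
Proof.
by move=> a b; rewrite -[q]cyclic_projK -!cyclic_projM mulrDl raddfD.
Qed.

HB.instance Definition _ := GRing.Zmodule_isLmodule.Build A cyclic_module
  cyclic_scaleA cyclic_scale1 cyclic_scaleDr cyclic_scaleDl.

Definition cyclic_gen : cyclic_module := cyclic_proj 1.

Lemma cyclic_projE x : cyclic_proj x = x *: cyclic_gen.
Proof. by rewrite -[RHS]cyclic_projM mulr1. Qed.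

Lemma cyclic_gen_rel x : rel x -> x *: cyclic_gen = 0.
Proof.
move=> relx; rewrite -cyclic_projE -(raddf0 cyclic_proj).
by apply/cyclic_projP; rewrite subr0; apply: left_ideal_gen_rel.
Qed.

Section Lift.
Variables (V : lmodType A) (v : V) (relv : forall x, rel x -> x *: v = 0).

Definition cyclic_lift of (forall x, rel x -> x *: v = 0) :=
  fun q : cyclic_module => repr q *: v.

Lemma cyclic_liftE x : cyclic_lift relv (x *: cyclic_gen) = x *: v.
Proof.
apply/eqP; rewrite -subr_eq0 -scalerBl; apply/eqP.
have: left_ideal_gen (repr (x *: cyclic_gen) - x).
  by apply/cyclic_projP; rewrite cyclic_projK cyclic_projE.
elim=> [y /relv // | | y z _ hy _ hz | a y _ hy].
- by rewrite scale0r.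
- by rewrite scalerDl hy hz addr0.
- by rewrite -scalerA hy scaler0.
Qed.

Fact cyclic_lift_linear : linear (cyclic_lift relv).
Proof.
move=> a p q; rewrite -[p]cyclic_projK -[q]cyclic_projK !cyclic_projE.
by rewrite scalerA -scalerDl !cyclic_liftE scalerDl scalerA.
Qed.

HB.instance Definition _ := GRing.isLinear.Build A cyclic_module V *:%R
  (cyclic_lift relv) cyclic_lift_linear.

Lemma cyclic_lift_gen : cyclic_lift relv cyclic_gen = v.
Proof. by rewrite -[cyclic_gen]scale1r cyclic_liftE scale1r. Qed.

End Lift.

End CyclicModule.

Section Image.
Variables (A : pzRingType) (U V : lmodType A) (f : {linear U -> V}).

Definition im_pred : {pred V} := fun v => `[< exists u, f u = v >].

Fact im_submod_closed : submod_closed im_pred.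
Proof.
split=> [|a v w]; rewrite !unfold_in.
  by apply/asboolP; exists 0; rewrite linear0.
move=> /asboolP[u <-] /asboolP[u' <-]; apply/asboolP.
by exists (a *: u + u'); rewrite linearP.
Qed.

HB.instance Definition _ := GRing.isSubmodClosed.Build A V im_pred
  im_submod_closed.

Definition im := {v : V | v \in im_pred}.

HB.instance Definition _ := SubType.on im.
HB.instance Definition _ := [Choice of im by <:].
HB.instance Definition _ := [SubChoice_isSubLmodule of im by <:].

End Image.

Definition irreducible (A : pzRingType) (V : lmodType A) : Prop :=
  (exists v : V, v != 0) /\
  forall W : submodClosed V, (forall w, w \in W -> w = 0) \/ (forall v, v \in W).

(* Positions in a residue sequence, and the indices of the generators [y] and
   [psi] below, are numbered from 1; out-of-range generators are 0. *)
Definition res e n (i : n.-tuple 'Z_e) (r : nat) : 'Z_e := nth 0 i r.-1.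

Definition swap_res e n (r : nat) (i : n.-tuple 'Z_e) : n.-tuple 'Z_e :=
  [tuple res i (if k.+1 == r then r.+1 else if k.+1 == r.+1 then r else k.+1)
     | k < n].

Variant klr_gen e n :=
| GenE of n.-tuple 'Z_e
| GenY of {r : nat | (0 < r <= n)%N}
| GenPsi of {r : nat | (0 < r < n)%N}.

Section GenChoice.
Variables (e n : nat).

Definition gen_code (g : klr_gen e n) :
    n.-tuple 'Z_e + ({r : nat | (0 < r <= n)%N} + {r : nat | (0 < r < n)%N}) :=
  match g with
  | GenE i => inl i
  | GenY r => inr (inl r)
  | GenPsi r => inr (inr r)
  end.

Definition gen_decode
    (c : n.-tuple 'Z_e + ({r : nat | (0 < r <= n)%N} + {r : nat | (0 < r < n)%N})) :=
  match c with
  | inl i => GenE i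
  | inr (inl r) => GenY e r
  | inr (inr r) => GenPsi e r
  end.

Fact gen_codeK : cancel gen_code gen_decode. Proof. by case. Qed.

HB.instance Definition _ := Choice.copy (klr_gen e n) (can_type gen_codeK).

End GenChoice.

Section KLR.
Variables (F : fieldType) (e n : nat).

(* The free associative [F]-algebra on the generators: the monoid algebra of
   the free monoid [{fmonom _}]. *)
Definition klr_free : pzRingType := {malg F[{fmonom klr_gen e n}]}.

Definition free_gen (g : klr_gen e n) : klr_free :=
  (<< fmu g >> : {malg F[{fmonom klr_gen e n}]}).

Definition free_e (i : n.-tuple 'Z_e) : klr_free := free_gen (GenE i).

Definition free_y (r : nat) : klr_free :=
  if insub r is Some r' then free_gen (GenY e r') else 0.

Definition free_psi (r : nat) : klr_free :=
  if insub r is Some r' then free_gen (GenPsi e r') else 0.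

Local Notation "'e( i )" := (free_e i) (at level 0, format "''e(' i )").
Local Notation y := free_y.
Local Notation psi := free_psi.

(* For [e >= 3] at most one of [i -> j] and [i <- j] holds, so the order of the
   tests below is immaterial. *)
Variant klr_rel : klr_free -> klr_free -> Prop :=
| klr_ee i j : klr_rel ('e(i) * 'e(j)) (if i == j then 'e(i) else 0)
| klr_1 : klr_rel (\sum_(i : n.-tuple 'Z_e) 'e(i)) 1
| klr_ye r i of (0 < r <= n)%N : klr_rel (y r * 'e(i)) ('e(i) * y r)
| klr_psie r i of (0 < r < n)%N :
    klr_rel (psi r * 'e(i)) ('e(swap_res r i) * psi r)
| klr_yy r s of (0 < r <= n)%N & (0 < s <= n)%N : klr_rel (y r * y s) (y s * y r)
| klr_psiy r s of (0 < r < n)%N & (0 < s <= n)%N & s != r & s != r.+1 :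
    klr_rel (psi r * y s) (y s * psi r)
| klr_psipsi r s of (0 < r < n)%N & (0 < s < n)%N & ((r.+1 < s) || (s.+1 < r))%N :
    klr_rel (psi r * psi s) (psi s * psi r)
| klr_psiyS r i of (0 < r < n)%N :
    klr_rel (psi r * y r.+1 * 'e(i))
            ((y r * psi r + (res i r == res i r.+1)%:R) * 'e(i))
| klr_ySpsi r i of (0 < r < n)%N :
    klr_rel (y r.+1 * psi r * 'e(i))
            ((psi r * y r + (res i r == res i r.+1)%:R) * 'e(i))
| klr_psi2 r i of (0 < r < n)%N :
    klr_rel (psi r ^+ 2 * 'e(i))
      (if res i r == res i r.+1 then 0
       else if res i r.+1 == res i r + 1 then (y r.+1 - y r) * 'e(i)
       else if res i r.+1 == res i r - 1 then (y r - y r.+1) * 'e(i)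
       else 'e(i))
| klr_braid r i of (0 < r)%N & (r.+1 < n)%N :
    klr_rel (psi r * psi r.+1 * psi r * 'e(i))
      (let b := psi r.+1 * psi r * psi r.+1 in
       if (res i r.+2 == res i r) && (res i r.+1 == res i r + 1)
       then (b + 1) * 'e(i)
       else if (res i r.+2 == res i r) && (res i r.+1 == res i r - 1)
       then (b - 1) * 'e(i)
       else b * 'e(i)).

(* [F] acts through the images of the constants [c%:MP], which are central;
   every two-sided ideal is stable under them. *)
Definition klr : pzRingType := ring_quot klr_rel.

Variable kappa : 'Z_e * 'Z_e.

Definition cyc_mult (i : 'Z_e) : nat := ((kappa.1 == i) + (kappa.2 == i))%N.

Variant cyc_rel : klr -> klr -> Prop :=
| cyc_y1 (i : n.-tuple 'Z_e) :
    cyc_rel (ring_proj klr_rel (y 1%N ^+ cyc_mult (res i 1%N) * 'e(i))) 0.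

Definition cklr : pzRingType := ring_quot cyc_rel.

Definition free_to_cklr : {rmorphism klr_free -> cklr} :=
  ring_proj cyc_rel \o ring_proj klr_rel.

Definition cklr_e i : cklr := free_to_cklr 'e(i).
Definition cklr_y r : cklr := free_to_cklr (y r).
Definition cklr_psi r : cklr := free_to_cklr (psi r).

End KLR.

Arguments cklr_y {F e n} kappa r.
Arguments cklr_psi {F e n} kappa r.

Section HookSpecht.
Variables (F : fieldType) (e n : nat) (kappa : 'Z_e * 'Z_e).

Local Notation A := (cklr F n kappa).
Local Notation "'e( i )" := (cklr_e F kappa i) (at level 0, format "''e(' i )").
Local Notation y := (@cklr_y F e n kappa).
Local Notation psi := (@cklr_psi F e n kappa).

Section Module.
Variable m : nat.

Definition hook_res : n.-tuple 'Z_e :=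
  [tuple if (k < m)%N then kappa.2 - (k : nat)%:R else kappa.1 + (k - m)%:R
     | k < n].

Variant specht_rel : A -> Prop :=
| specht_e : specht_rel ('e(hook_res) - 1)
| specht_y r of (0 < r <= n)%N : specht_rel (y r)
| specht_psi r of (0 < r < n)%N & r != m : specht_rel (psi r).

(* The Specht module labelled by the bipartition [((n - m), (1^m))], for
   [m <= n], presented over the cyclotomic algebra. *)
Definition specht : lmodType A := cyclic_module specht_rel.

Definition specht_z : specht := cyclic_gen specht_rel.

(* psi_{a-1} ... psi_j, equal to 1 if [a <= j] *)
Definition psi_down (a j : nat) : A := \prod_(r <- rev (index_iota j a)) psi r.

Definition specht_v (a : seq nat) : specht :=
  (\prod_(0 <= j < size a) psi_down (nth 0%N a j) j.+1) *: specht_z.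

End Module.

End HookSpecht.

Lemma res_tuple e n (f : nat -> 'Z_e) r : (0 < r <= n)%N ->
  res [tuple f k | k < n] r = f r.-1.
Proof.
case: r => // r rn; rewrite /res.
by rewrite -(tnth_nth 0 _ (Ordinal rn)) tnth_mktuple.
Qed.

Lemma res_ext e n (i j : n.-tuple 'Z_e) :
  (forall r, (0 < r <= n)%N -> res i r = res j r) -> i = j.
Proof.
move=> h; apply: eq_from_tnth => k; rewrite !(tnth_nth 0).
by have := h k.+1; rewrite /res /=; apply; exact: ltn_ord.
Qed.

Lemma res_swap e n r s (i : n.-tuple 'Z_e) : (0 < s <= n)%N ->
  res (swap_res r i) s =
  res i (if s == r then r.+1 else if s == r.+1 then r else s).
Proof.
case: s => // s hs.
exact: (res_tuple
  (fun k => res i (if k.+1 == r then r.+1 else if k.+1 == r.+1 then r else k.+1))).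
Qed.

(* Well-definedness of [hook_hom] below: [d k] stands for
   psi_{k-1} ... psi_{m+1} z, with [z] generating the target Specht module.
   The ring is abstract because unification is slow on the concrete algebra. *)
Section HookChain.
Variables (e n m : nat) (kappa : 'Z_e * 'Z_e).
Hypotheses (e_gt2 : (2 < e)%N) (mn : (m < n)%N)
  (n_kappa : n%:R = kappa.2 - kappa.1 + 1).

Variables (A : pzRingType) (E : n.-tuple 'Z_e -> A) (y psi : nat -> A).
Hypothesis psi_e : forall r i, (0 < r < n)%N ->
  psi r * E i = E (swap_res r i) * psi r.
Hypothesis psi_y : forall r s, (0 < r < n)%N -> (0 < s <= n)%N ->
  s != r -> s != r.+1 -> psi r * y s = y s * psi r.
Hypothesis psi_psi : forall r s, (0 < r < n)%N -> (0 < s < n)%N ->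
  ((r.+1 < s) || (s.+1 < r))%N -> psi r * psi s = psi s * psi r.
Hypothesis psi_yS : forall r i, (0 < r < n)%N ->
  psi r * y r.+1 * E i = (y r * psi r + (res i r == res i r.+1)%:R) * E i.
Hypothesis yS_psi : forall r i, (0 < r < n)%N ->
  y r.+1 * psi r * E i = (psi r * y r + (res i r == res i r.+1)%:R) * E i.
Hypothesis psi2 : forall r i, (0 < r < n)%N ->
  psi r * psi r * E i =
  if res i r == res i r.+1 then 0
  else if res i r.+1 == res i r + 1 then (y r.+1 - y r) * E i
  else if res i r.+1 == res i r - 1 then (y r - y r.+1) * E i
  else E i.
Hypothesis braid : forall r i, (0 < r)%N -> (r.+1 < n)%N ->
  psi r * psi r.+1 * psi r * E i =
  (let b := psi r.+1 * psi r * psi r.+1 in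
   if (res i r.+2 == res i r) && (res i r.+1 == res i r + 1)
   then (b + 1) * E i
   else if (res i r.+2 == res i r) && (res i r.+1 == res i r - 1)
   then (b - 1) * E i
   else b * E i).

Variables (V : lmodType A) (d : nat -> V).
Hypothesis dS : forall k, (m < k)%N -> d k.+1 = psi k *: d k.
Hypothesis d0_e : E (hook_res n kappa m.+1) *: d m.+1 = d m.+1.
Hypothesis d0_y : forall r, (0 < r <= n)%N -> y r *: d m.+1 = 0.
Hypothesis d0_psi : forall r, (0 < r < n)%N -> r != m.+1 -> psi r *: d m.+1 = 0.

Let two_neq0 : (2%:R : 'Z_e) != 0.
Proof.
apply/eqP => h; have := val_Zp_nat (ltnW e_gt2) 2.
by rewrite h modn_small.
Qed.

Let chain_fun (k j : nat) : 'Z_e :=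
  if (j < m)%N then kappa.2 - j%:R
  else if (j.+1 < k)%N then kappa.1 + (j - m)%:R
  else if j.+1 == k then kappa.2 - m%:R
  else kappa.1 + (j - m)%:R - 1.

Let chain_res k : n.-tuple 'Z_e := [tuple chain_fun k j | j < n].

Let chain_resE k r : (0 < r <= n)%N -> res (chain_res k) r =
  if (r.-1 < m)%N then kappa.2 - (r.-1)%:R
  else if (r.-1.+1 < k)%N then kappa.1 + (r.-1 - m)%:R
  else if r.-1.+1 == k then kappa.2 - m%:R
  else kappa.1 + (r.-1 - m)%:R - 1.
Proof. exact: (res_tuple (chain_fun k)). Qed.

Let chain_res_lt k r : (m < r)%N -> (r < k)%N -> (r <= n)%N ->
  res (chain_res k) r = kappa.1 + r%:R - m%:R - 1.
Proof.
case: r => // r mr rk rn; rewrite chain_resE //= ltnNge -ltnS mr /= rk.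
by rewrite natrB // -[r.+1]addn1 natrD; ring.
Qed.

Let chain_res_eq k : (m < k <= n)%N -> res (chain_res k) k = kappa.2 - m%:R.
Proof.
case: k => // k /andP[mk kn]; rewrite chain_resE //= ltnNge -ltnS mk /=.
by rewrite ltnn eqxx.
Qed.

Let chain_res_gt k r : (m < k)%N -> (k < r <= n)%N ->
  res (chain_res k) r = kappa.1 + r%:R - m%:R - 2%:R.
Proof.
case: r => // r mk /andP[kr rn]; rewrite chain_resE //=.
have mr : (m < r.+1)%N by apply: ltn_trans kr.
rewrite ltnNge -ltnS mr /= ltnNge (ltnW kr) /= gtn_eqF //.
by rewrite natrB // -[r.+1]addn1 natrD; ring.
Qed.

Let chain_ind (P : nat -> Prop) : P m.+1 ->
  (forall k, (m < k < n)%N -> P k -> P k.+1) -> forall k, (m < k <= n)%N -> P k.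
Proof.
move=> P0 PS; elim=> // k ih /andP[]; rewrite ltnS leq_eqVlt => /orP[/eqP <- //|].
by move=> mk kn; apply: PS; rewrite ?mk //; apply: ih; rewrite mk ltnW.
Qed.

Let chain_res_swap k : (m < k < n)%N ->
  swap_res k (chain_res k) = chain_res k.+1.
Proof.
move=> /andP[mk kn]; apply: res_ext => r hr.
rewrite res_swap //.
have [->|rk] := eqVneq r k.
  rewrite (@chain_res_lt k.+1) // ?(ltnW kn) // chain_res_gt ?ltnSn //.
  by rewrite -[k.+1]addn1 natrD; ring.
have [->|rSk] := eqVneq r k.+1.
  by rewrite !chain_res_eq ?mk ?kn ?(ltnW mk) ?(ltnW kn) // (leq_trans mk).
have r0 : (0 < r)%N by case/andP: hr.
rewrite !chain_resE //; case: ltnP => // _.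
rewrite prednK // (negbTE rk) (negbTE rSk) ltnS [(r <= k)%N]leq_eqVlt.
by rewrite (negbTE rk).
Qed.

Let d_e k : (m < k <= n)%N -> E (chain_res k) *: d k = d k.
Proof.
move: k; apply: chain_ind => [|k /andP[mk kn] ih].
  have -> : chain_res m.+1 = hook_res n kappa m.+1; last exact: d0_e.
  apply: eq_mktuple => j; rewrite /chain_fun eqSS !ltnS.
  case: (ltngtP j m) => [jm|mj|->] //=.
  by rewrite -(subnSK mj) -[(j - m.+1).+1]addn1 natrD; ring.
have k0 : (0 < k < n)%N by rewrite kn (leq_ltn_trans _ mk).
by rewrite dS // -chain_res_swap ?mk // scalerA -psi_e // -scalerA ih.
Qed.

Let d_split (x x' : A) k : (m < k <= n)%N ->
  x * E (chain_res k) = x' * E (chain_res k) -> x *: d k = x' *: d k.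
Proof. by move=> hk h; rewrite -(d_e hk) !scalerA h. Qed.

Let psi_d_far s k : (m < k <= n)%N -> (0 < s < n)%N ->
  (s <= m)%N && (s != m) || (k < s)%N -> psi s *: d k = 0.
Proof.
move=> hk hs; move: k hk; apply: chain_ind => [h|k /andP[mk kn] ih h].
  by rewrite d0_psi //; lia.
rewrite dS // scalerA psi_psi; [|lia..].
by rewrite -scalerA ih ?scaler0 //; lia.
Qed.

Let y_d_far s k : (m < k <= n)%N -> (0 < s <= n)%N ->
  (s <= m)%N || (k < s)%N -> y s *: d k = 0.
Proof.
move=> hk hs; move: k hk; apply: chain_ind => [h|k /andP[mk kn] ih h].
  by rewrite d0_y.
rewrite dS // scalerA -psi_y; [|lia..].
by rewrite -scalerA ih ?scaler0 //; lia.
Qed.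

(* the moving strand meets an equal residue only away from the end *)
Let chain_delta k : (m < k < n)%N ->
  res (chain_res k) k == res (chain_res k) k.+1 -> (k.+2 < n)%N.
Proof.
move=> /andP[mk kn]; rewrite chain_res_eq ?mk ?(ltnW kn) //.
rewrite chain_res_gt ?ltnSn // => /eqP h.
have {}h : n%:R = k%:R :> 'Z_e.
  by rewrite n_kappa -[kappa.2](subrK m%:R) h -[k.+1]addn1 natrD; ring.
rewrite ltn_neqAle; apply/andP; split; last first.
  rewrite ltn_neqAle kn andbT; apply/eqP => kn1.
  move: h; rewrite -kn1 -[k.+1]addn1 natrD => /eqP.
  by rewrite -subr_eq0 addrC addKr oner_eq0.
apply/eqP => kn2.
move: h; rewrite -kn2 -[k.+2]addn2 natrD => /eqP.
by rewrite -subr_eq0 addrC addKr (negbTE two_neq0).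
Qed.

Let delta k : A := (res (chain_res k) k == res (chain_res k) k.+1)%:R.

Let y_d_top k : (m < k < n)%N -> y k.+1 *: d k.+1 = delta k *: d k.
Proof.
have top k' : (m < k' < n)%N ->
    y k'.+1 *: d k'.+1 = psi k' *: (y k' *: d k') + delta k' *: d k'.
  move=> hk; rewrite dS ?scalerA -?scalerDl; last by case/andP: hk.
  by apply: d_split; [lia | rewrite yS_psi //; lia].
elim: k => // k ih hk; rewrite top //.
suff -> : psi k.+1 *: (y k.+1 *: d k.+1) = 0 by rewrite add0r.
have [mk|km] := ltnP m k; last first.
  have -> : k = m by lia.
  by rewrite d0_y ?scaler0 //; lia.
rewrite ih; last lia.
rewrite /delta scalerA (commr_nat (psi k.+1)) -scalerA.
by rewrite psi_d_far ?scaler0 //; lia.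
Qed.

Lemma chain_e : E (hook_res n kappa m) *: d n = d n.
Proof.
suff -> : hook_res n kappa m = chain_res n by rewrite d_e // mn leqnn.
apply: eq_mktuple => j; rewrite /chain_fun; case: ltnP => // mj.
have := ltn_ord j; rewrite leq_eqVlt => /orP[/eqP jn|->//].
rewrite jn ltnn eqxx natrB //; apply/eqP; rewrite -subr_eq0; apply/eqP.
have -> : (j : nat)%:R = n%:R - 1 :> 'Z_e.
  by rewrite -[in RHS]jn -[j.+1]addn1 natrD addrK.
by rewrite n_kappa; ring.
Qed.

Lemma chain_y s : (0 < s <= n)%N -> y s *: d n = 0.
Proof.
move=> hs; have [sm|ms] := leqP s m.
  by apply: y_d_far; rewrite ?sm ?mn ?leqnn.
have delta0 k : (m < k < n)%N -> (n <= k.+2)%N -> delta k = 0.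
  move=> hk hkn; rewrite /delta; case: eqP => // /eqP /(chain_delta hk); lia.
have [sn|ns] := ltnP s n; last first.
  have [k nk] : exists k, k.+1 = n by exists n.-1; lia.
  have -> : s = k.+1 by lia.
  rewrite -nk; have [mk|km] := ltnP m k; last first.
    by have -> : k = m; [lia | apply: d0_y; lia].
  rewrite y_d_top; last lia.
  by rewrite delta0 ?scale0r //; lia.
have yd1 : y s *: d s.+1 = - (delta s *: d s).
  apply/eqP; rewrite -addr_eq0 dS // scalerA -scalerDl; apply/eqP.
  transitivity ((psi s * y s.+1) *: d s).
    by apply: d_split; [lia | rewrite psi_yS //; lia].
  by rewrite -scalerA y_d_far ?scaler0 //; lia.
have yd2 k : (s.+1 < k <= n)%N -> y s *: d k = 0.
  elim: k => // k ih hk; rewrite dS; last lia.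
  rewrite scalerA -psi_y; [|lia..].
  rewrite -scalerA; have [sk|ks] := ltnP s.+1 k.
    by rewrite ih ?scaler0 //; lia.
  have -> : k = s.+1 by lia.
  rewrite yd1 scalerN scalerA /delta (commr_nat (psi s.+1)) -scalerA.
  by rewrite psi_d_far ?scaler0 ?oppr0 //; lia.
have [sn1|] := ltnP s.+1 n; first by rewrite yd2 ?sn1 ?leqnn.
move=> ns; have sn1 : s.+1 = n by lia.
by rewrite -[in d n]sn1 yd1 delta0 ?scale0r ?oppr0 //; lia.
Qed.

Lemma chain_psi s : (0 < s < n)%N -> s != m -> psi s *: d n = 0.
Proof.
move=> hs sm; have [lt_sm|ms] := ltnP s m.
  by rewrite psi_d_far //; lia.
have {sm} ms : (m < s)%N by rewrite ltn_neqAle eq_sym sm.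
have res_s : res (chain_res s) s = kappa.2 - m%:R.
  by apply: chain_res_eq; lia.
have res_s1 : res (chain_res s) s.+1 = kappa.1 + s%:R - m%:R - 1.
  rewrite chain_res_gt; [|lia..].
  by rewrite -[s.+1]addn1 natrD; ring.
have kap2 : kappa.2 = n%:R + kappa.1 - 1 by rewrite n_kappa; ring.
have [sn1|ns1] := ltnP s.+1 n; last first.
  have sn : s.+1 = n by lia.
  have nE : n%:R = s%:R + 1 :> 'Z_e by rewrite -[in LHS]sn -natr1.
  rewrite -[in d n]sn dS // scalerA.
  have eq1 : res (chain_res s) s.+1 = res (chain_res s) s - 1.
    by rewrite res_s res_s1 kap2 nE; ring.
  transitivity ((y s - y s.+1) *: d s).
    apply: d_split; first lia.
    rewrite psi2 // eq1 -subr_eq0 opprB addrC subrK oner_eq0.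
    have -> : (res (chain_res s) s - 1 == res (chain_res s) s + 1) = false.
      apply/negbTE; rewrite -subr_eq0 opprD addrACA subrr add0r -opprD oppr_eq0.
      exact: two_neq0.
    by rewrite eqxx.
  rewrite scalerBl (@y_d_far s.+1) ?subr0; [|lia..].
  have [k sk] : exists k, k.+1 = s by exists s.-1; lia.
  rewrite -sk; have [mk|km] := ltnP m k; last first.
    by have -> : k = m; [lia | apply: d0_y; lia].
  rewrite y_d_top; last lia.
  rewrite /delta; case: eqP => [/eqP h|_]; last by rewrite scale0r.
  by have : (k.+2 < n)%N; [apply: chain_delta => //; lia | lia].
have res_s2 : res (chain_res s) s.+2 = kappa.1 + s%:R - m%:R.
  rewrite chain_res_gt; [|lia..].
  by rewrite -[s.+2]addn2 natrD; ring.
pose eps : A := (res (chain_res s) s.+2 == res (chain_res s) s)%:R.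
have psi_d2 : psi s *: d s.+2 = - (eps *: d s).
  rewrite dS; last lia.
  rewrite dS // !scalerA -scaleNr.
  transitivity ((psi s.+1 * psi s * psi s.+1 - eps) *: d s).
    apply: d_split; first lia.
    rewrite braid /eps //; last lia.
    have [h|h] /= := eqVneq (res (chain_res s) s.+2); last by rewrite subr0.
    have -> : res (chain_res s) s.+1 = res (chain_res s) s - 1.
      by rewrite -h res_s1 res_s2.
    have -> : (res (chain_res s) s - 1 == res (chain_res s) s + 1) = false.
      apply/negbTE; rewrite -subr_eq0 opprD addrACA subrr add0r -opprD oppr_eq0.
      exact: two_neq0.
    by rewrite eqxx.
  rewrite scalerBl -scalerA psi_d_far; [|lia..].
  by rewrite scaler0 sub0r scaleNr.
have psi_d3 k : (s.+2 < k <= n)%N -> psi s *: d k = 0.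
  elim: k => // k ih hk; rewrite dS; last lia.
  rewrite scalerA psi_psi; [|lia..].
  rewrite -scalerA; have [sk|ks] := ltnP s.+2 k.
    by rewrite ih ?scaler0 //; lia.
  have -> : k = s.+2 by lia.
  rewrite psi_d2 scalerN scalerA /eps (commr_nat (psi s.+2)) -scalerA.
  by rewrite psi_d_far ?scaler0 ?oppr0 //; lia.
have [sn2|ns2] := ltnP s.+2 n; first by rewrite psi_d3 ?sn2 ?leqnn.
have sn2 : s.+2 = n by lia.
rewrite -[in d n]sn2 psi_d2 /eps res_s res_s2.
have nE : n%:R = s%:R + 2%:R :> 'Z_e by rewrite -[in LHS]sn2 -[s.+2]addn2 natrD.
have -> : (kappa.1 + s%:R - m%:R == kappa.2 - m%:R) = false.
  rewrite kap2 nE -subr_eq0 -oppr_eq0.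
  have -> : - (kappa.1 + s%:R - m%:R - (s%:R + 2%:R + kappa.1 - 1 - m%:R)) = 1
    by ring.
  exact: oner_eq0.
by rewrite scale0r oppr0.
Qed.

End HookChain.

Lemma prod_rcons_iota (A : pzRingType) (g : nat -> nat -> A) m n :
  (forall j, g j j = 1) ->
  \prod_(0 <= j < size (rcons (iota 1 m) n)) g (nth 0%N (rcons (iota 1 m) n) j) j.+1
  = g n m.+1.
Proof.
move=> g1; rewrite size_rcons size_iota big_nat_recr //=.
rewrite nth_rcons size_iota ltnn eqxx big_nat big1 ?mul1r // => j /andP[_ jm].
by rewrite nth_rcons size_iota jm nth_iota // add1n.
Qed.

(* Images of the shapes of both sides of the defining relations, for an
   abstract morphism: unification is slow on the concrete algebras. *)
Section MorphismShapes.
Variables (R A : pzRingType) (f : {rmorphism R -> A}).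

Fact morph_M2 x x' : f (x * x') = f x * f x'. Proof. exact: rmorphM. Qed.

Fact morph_M3 x x' x'' : f (x * x' * x'') = f x * f x' * f x''.
Proof. by rewrite !rmorphM. Qed.

Fact morph_yS x x' k x'' :
  f ((x * x' + k%:R) * x'') = (f x * f x' + k%:R) * f x''.
Proof. by rewrite rmorphM rmorphD rmorphM rmorph_nat. Qed.

Fact morph_psi2l x x' : f (x ^+ 2 * x') = f x * f x * f x'.
Proof. by rewrite expr2 !rmorphM. Qed.

Fact morph_psi2r (c c' c'' : bool) x x' q :
  f (if c then 0 else if c' then (x' - x) * q else if c'' then (x - x') * q
     else q) =
  if c then 0 else if c' then (f x' - f x) * f q
  else if c'' then (f x - f x') * f q else f q.
Proof.
by case: c; [|case: c'; [|case: c'']]; rewrite ?rmorph0 ?rmorphM ?rmorphB.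
Qed.

Fact morph_braidl p q x : f (p * q * p * x) = f p * f q * f p * f x.
Proof. by rewrite !rmorphM. Qed.

Fact morph_braidr (c c' : bool) p q x :
  f (let b := p * q * p in
     if c then (b + 1) * x else if c' then (b - 1) * x else b * x) =
  (let b := f p * f q * f p in
   if c then (b + 1) * f x else if c' then (b - 1) * f x else b * f x).
Proof.
case: c => /=; [|case: c' => /=].
- by rewrite rmorphM rmorphD rmorph1 !rmorphM.
- by rewrite rmorphM rmorphB rmorph1 !rmorphM.
- by rewrite !rmorphM.
Qed.

End MorphismShapes.

Section HookHom.
Variables (F : fieldType) (e n : nat) (kappa : 'Z_e * 'Z_e).

Local Notation A := (cklr F n kappa).
Local Notation "'e( i )" := (cklr_e F kappa i) (at level 0, format "''e(' i )").
Local Notation y := (@cklr_y F e n kappa).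
Local Notation psi := (@cklr_psi F e n kappa).
Local Notation phi := (@free_to_cklr F e n kappa).

Lemma cklr_relE x x' : klr_rel x x' -> phi x = phi x'.
Proof.
by move=> h; congr ring_proj; apply/ring_projP; apply: ideal_gen_rel.
Qed.

Lemma cklr_psi_e r i : (0 < r < n)%N -> psi r * 'e(i) = 'e(swap_res r i) * psi r.
Proof.
move=> hr; exact: etrans (esym (morph_M2 phi _ _))
  (etrans (cklr_relE (klr_psie F i hr)) (morph_M2 phi _ _)).
Qed.

Lemma cklr_psi_y r s : (0 < r < n)%N -> (0 < s <= n)%N -> s != r -> s != r.+1 ->
  psi r * y s = y s * psi r.
Proof.
move=> hr hs n1 n2; exact: etrans (esym (morph_M2 phi _ _))
  (etrans (cklr_relE (klr_psiy F e hr hs n1 n2)) (morph_M2 phi _ _)).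
Qed.

Lemma cklr_psi_psi r s : (0 < r < n)%N -> (0 < s < n)%N ->
  ((r.+1 < s) || (s.+1 < r))%N -> psi r * psi s = psi s * psi r.
Proof.
move=> hr hs h; exact: etrans (esym (morph_M2 phi _ _))
  (etrans (cklr_relE (klr_psipsi F e hr hs h)) (morph_M2 phi _ _)).
Qed.

Lemma cklr_psi_yS r i : (0 < r < n)%N ->
  psi r * y r.+1 * 'e(i) =
  (y r * psi r + (res i r == res i r.+1)%:R) * 'e(i).
Proof.
move=> hr; exact: etrans (esym (morph_M3 phi _ _ _))
  (etrans (cklr_relE (klr_psiyS F i hr)) (morph_yS phi _ _ _ _)).
Qed.

Lemma cklr_yS_psi r i : (0 < r < n)%N ->
  y r.+1 * psi r * 'e(i) =
  (psi r * y r + (res i r == res i r.+1)%:R) * 'e(i).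
Proof.
move=> hr; exact: etrans (esym (morph_M3 phi _ _ _))
  (etrans (cklr_relE (klr_ySpsi F i hr)) (morph_yS phi _ _ _ _)).
Qed.

Lemma cklr_psi2 r i : (0 < r < n)%N ->
  psi r * psi r * 'e(i) =
  if res i r == res i r.+1 then 0
  else if res i r.+1 == res i r + 1 then (y r.+1 - y r) * 'e(i)
  else if res i r.+1 == res i r - 1 then (y r - y r.+1) * 'e(i)
  else 'e(i).
Proof.
move=> hr; exact: etrans (esym (morph_psi2l phi _ _))
  (etrans (cklr_relE (klr_psi2 F i hr)) (morph_psi2r phi _ _ _ _ _ _)).
Qed.

Lemma cklr_braid r i : (0 < r)%N -> (r.+1 < n)%N ->
  psi r * psi r.+1 * psi r * 'e(i) =
  (let b := psi r.+1 * psi r * psi r.+1 in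
   if (res i r.+2 == res i r) && (res i r.+1 == res i r + 1)
   then (b + 1) * 'e(i)
   else if (res i r.+2 == res i r) && (res i r.+1 == res i r - 1)
   then (b - 1) * 'e(i)
   else b * 'e(i)).
Proof.
move=> r0 hr; exact: etrans (esym (morph_braidl phi _ _ _))
  (etrans (cklr_relE (klr_braid F i r0 hr)) (morph_braidr phi _ _ _ _ _)).
Qed.

Local Notation z m := (specht_z F n kappa m).

Lemma specht_z_e m : 'e(hook_res n kappa m) *: z m = z m.
Proof.
apply/eqP; rewrite -subr_eq0 -{2}[z m]scale1r -scalerBl; apply/eqP.
exact/cyclic_gen_rel/specht_e.
Qed.

Lemma specht_z_y m r : (0 < r <= n)%N -> y r *: z m = 0.
Proof. by move=> hr; exact/cyclic_gen_rel/specht_y. Qed.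

Lemma specht_z_psi m r : (0 < r < n)%N -> r != m -> psi r *: z m = 0.
Proof. by move=> hr rm; exact/cyclic_gen_rel/specht_psi. Qed.

Variable m : nat.

Let d k := psi_down F n kappa k m.+1 *: z m.+1.

Let dS k : (m < k)%N -> d k.+1 = psi k *: d k.
Proof.
move=> mk; rewrite /d scalerA; congr (_ *: _); rewrite /psi_down.
rewrite /index_iota subSn // -[(k - m.+1).+1]addn1 iotaD subnKC // rev_cat.
by rewrite big_cons.
Qed.

Let d0 : d m.+1 = z m.+1.
Proof. by rewrite /d /psi_down /index_iota subnn big_nil scale1r. Qed.

(* v(1, ..., m, n) *)
Definition hook_target : specht F n kappa m.+1 :=
  specht_v F n kappa m.+1 (rcons (iota 1 m) n).

Lemma hook_targetE : hook_target = d n.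
Proof.
rewrite /hook_target /specht_v prod_rcons_iota //.
by move=> j; rewrite /psi_down /index_iota subnn big_nil.
Qed.

Hypotheses (e_gt2 : (2 < e)%N) (mn : (m < n)%N)
  (n_kappa : n%:R = kappa.2 - kappa.1 + 1).

Lemma hook_target_rel x : specht_rel m x -> x *: hook_target = 0.
Proof.
have d0_e : 'e(hook_res n kappa m.+1) *: d m.+1 = d m.+1.
  by rewrite d0 specht_z_e.
have d0_y r : (0 < r <= n)%N -> y r *: d m.+1 = 0.
  by rewrite d0; exact: specht_z_y.
have d0_psi r : (0 < r < n)%N -> r != m.+1 -> psi r *: d m.+1 = 0.
  by rewrite d0; exact: specht_z_psi.
rewrite hook_targetE; move: dS d0_e d0_y d0_psi; move: (d) => d' dS' he hy hpsi.
case=> {x} [|r hr|r hr rm].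
- rewrite scalerBl scale1r; apply/eqP; rewrite subr_eq0; apply/eqP.
  exact: (chain_e mn n_kappa cklr_psi_e dS' he).
- exact: (chain_y e_gt2 mn n_kappa cklr_psi_e cklr_psi_y cklr_psi_psi
           cklr_psi_yS cklr_yS_psi dS' he hy hpsi).
- exact: (chain_psi e_gt2 mn n_kappa cklr_psi_e cklr_psi_y cklr_psi_psi
           cklr_yS_psi cklr_psi2 cklr_braid dS' he hy hpsi).
Qed.

Definition hook_hom : {linear specht F n kappa m -> specht F n kappa m.+1} :=
  cyclic_lift hook_target_rel.

Lemma hook_homE : hook_hom (z m) = hook_target.
Proof. exact: cyclic_lift_gen. Qed.

End HookHom.

(* Main.v *)
From HB Require Import structures.
From mathcomp Require Import all_boot all_order all_algebra.
From mathcomp Require Import boolp ring zify.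
From mathcomp Require Import monalg.
Require Import Defs.

(* The action of the generators on the standard basis is explicit and local.
   Encode v(a_1, ..., a_m) as a word in the letters leg/arm. The residues of a
   leg and of an arm at position r agree iff r = n mod e, and then psi_r, y_r,
   y_{r+1} act on the two letters at r, r + 1 as in the nil-Hecke algebra; next
   to such a position psi may also exchange two letters at distance 2, and
   elsewhere psi exchanges neighbours. These rules define a module on functions
   of words, the relations being finite checks on windows of at most 7 letters.

   The Specht module is spanned by the standard vectors, by induction on the
   length of the shuffle, so its map to that module is injective, and the image
   of gamma_m becomes the span of the words with a leg at position n. As e does
   not divide n, each p < n with p = n mod e is followed and p = 0 never occurs,
   so inside a nonzero element of the image one can move legs to the left until
   the word of v(1, ..., m, n) occurs; its residue idempotent, together with the
   nil-Hecke projector at m if m = n mod e, isolates it. *)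

Set Implicit Arguments.
Unset Strict Implicit.
Unset Printing Implicit Defensive.

Import GRing.Theory.

Local Open Scope ring_scope.

(** * Words and local moves *)

(** A presentation bounds the Specht module only from above, so a model is needed in which the
    standard vectors are visibly independent. Its rules are found by computing with the relations.
    Exchanges at distance 2 arise in two ways near a position where a leg and an arm have equal
    residues: from the term plus or minus 1 of the braid relation ([psi_r] on arm, arm, leg gives
    plus or minus leg, arm, arm), and from the [y]'s in the square of [psi_r], which produce a
    Kronecker delta when they pass the next [psi].

    Functions on words, rather than combinations of words, make every generator read a single value
    of its argument up to sign. A product of generators is then evaluated by following one word, and
    each relation becomes a comparison of a few signed values.

    As [e] is at least 3, exceptional positions are at least 3 apart, so at most one of them lies
    among the three that a given [psi] consults. If [e] divided [n], position 0 would be exceptional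
    and [psi_1] would involve the padding letter there; the hypothesis on [kappa] excludes this. *)

Section LetterMoves.
Variables (V : zmodType) (T : Type).
Variables (get : T -> nat -> bool) (swp : nat -> nat -> T -> T).

Definition move := (option bool * nat * nat)%type.

Definition sgn_opt (o : option bool) (x : V) : V :=
  if o is Some b then (if b then x else - x) else 0.

(** Parametric in [T], so that one rule acts on infinite words and on finite lists of letters; the
    missing sign [None] stands for the zero operator. *)
Definition move_op (mv : (nat -> bool) -> move) (f : T -> V) (w : T) : V :=
  let: (o, x, y) := mv (get w) in sgn_opt o (f (swp x y w)).

End LetterMoves.

(* Right actions of psi_{q+1} and y_{q+1} on words, i.e. the transposes of their
   matrices in the standard basis: (psi f)(w) is plus or minus f at the moved
   word, or 0. [C r] stands for r = n mod e. *)
Section Moves.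
Variable C : nat -> bool.

Definition psi_move (q : nat) (g : nat -> bool) : move :=
  if ~~ g q.+1 && g q.+2 then (Some true, q.+1, q.+2)
  else if C q.+1 then (None, q, q)
  else if C q.+2 then
    (if g q.+1 && ~~ g q.+3 then (Some (g q.+2), q.+1, q.+3) else (None, q, q))
  else if C q then
    (if g q && ~~ g q.+2 then (Some (g q.+1), q, q.+2) else (None, q, q))
  else if g q.+1 && ~~ g q.+2 then (Some true, q.+1, q.+2) else (None, q, q).

Definition y_move (q : nat) (g : nat -> bool) : move :=
  if [&& C q.+1, g q.+1 & ~~ g q.+2] then (Some false, q.+1, q.+2)
  else if [&& C q, g q & ~~ g q.+1] then (Some true, q, q.+1)
  else (None, q, q).

End Moves.

(* A subset [a_1 < ... < a_m] of [1, ..., n] as a word: [true] at the positions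
   [a_j] of the leg, [false] on the arm. Position 0 and the positions beyond [n]
   are padding, so that no local rule has to treat the ends apart. *)
Definition word := nat -> bool.

Definition swap (x y : nat) (w : word) : word :=
  fun k => if k == x then w y else if k == y then w x else w k.

(** The default value [w k] of [nth] keeps the letters of [w] beyond the end of [l], so only a
    window of length [size l] is overwritten. *)
Definition put (s : nat) (l : seq bool) (w : word) : word :=
  fun k => if (k < s)%N then w k else nth (w k) l (k - s).

Definition lswap (x y : nat) (l : seq bool) : seq bool :=
  mkseq (fun k => swap x y (nth false l) k) (size l).

Lemma put_get s l w i : (i < size l)%N -> put s l w (s + i)%N = nth false l i.
Proof.
by move=> il; rewrite /put ltnNge leq_addr /= addKn; apply: set_nth_default.
Qed.

Lemma put_swap s l w i j : (i < size l)%N -> (j < size l)%N ->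
  swap (s + i) (s + j) (put s l w) = put s (lswap i j l) w.
Proof.
move=> il jl; apply: funext => k; rewrite {1}/swap !put_get //.
rewrite /put; case: ltnP => [ks|sk].
  by rewrite !ltn_eqF ?(leq_trans ks) ?leq_addr.
rewrite -{1 2}(subnKC sk) !eqn_add2l.
have [kl|lk] := ltnP (k - s) (size l); last first.
  by rewrite !gtn_eqF ?(leq_trans _ lk) // !nth_default // size_mkseq.
rewrite nth_mkseq // /swap; do 2!case: ifP => // _.
exact: set_nth_default.
Qed.

Lemma put_id s k w : put s (mkseq (fun i => w (s + i)%N) k) w = w.
Proof.
apply: funext => j; rewrite /put; case: ltnP => // sj.
have [jk|kj] := ltnP (j - s) k; last by rewrite nth_default ?size_mkseq.
by rewrite nth_mkseq // subnKC.
Qed.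

Lemma size_lswap x y l : size (lswap x y l) = size l.
Proof. exact: size_mkseq. Qed.

Section Window.
Variables (V : zmodType) (C : nat -> bool).

Local Notation wop := (@move_op V word id swap).
Local Notation lop := (@move_op V (seq bool) (nth false) lswap).

(** The bridge from infinite words to finite checks: with the letters outside the window frozen, [f]
    is a function [g] of the [k] letters inside, and this survives the operators whose moves fit
    into the window. *)
Definition window_ext s k w (f : word -> V) (g : seq bool -> V) :=
  forall l, size l = k -> f (put s l w) = g l.

Lemma window_psi s k w f g q : (q.+3 < k)%N -> window_ext s k w f g ->
  window_ext s k w (wop (psi_move C (s + q)) f)
                   (lop (psi_move (C \o addn s) q) g).
Proof.
move=> qk h l lk; rewrite /move_op /psi_move /= -!addnS !put_get; [|lia..].
by do !case: ifP => _ //; rewrite /sgn_opt put_swap ?h ?size_lswap //; lia.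
Qed.

Lemma window_y s k w f g q : (q.+2 < k)%N -> window_ext s k w f g ->
  window_ext s k w (wop (y_move C (s + q)) f) (lop (y_move (C \o addn s) q) g).
Proof.
move=> qk h l lk; rewrite /move_op /y_move /= -!addnS !put_get; [|lia..].
by do !case: ifP => _ //; rewrite /sgn_opt put_swap ?h ?size_lswap //; lia.
Qed.

Lemma window_refl s k w f : window_ext s k w f (fun l => f (put s l w)).
Proof. by []. Qed.

End Window.


(** * Finite checks of the relations on windows *)

Section LocalChecks.
Variables (V : zmodType) (C : nat -> bool).
Hypothesis C_sparse : forall k, C k -> ~~ C k.+1 && ~~ C k.+2.

Local Notation lop := (@move_op V (seq bool) (nth false) lswap).
Implicit Type g : seq bool -> V.

(** The generators in the checks below consult [C] at most at 0, ..., 5. Sparsity leaves only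
    patterns with marks at least 3 apart; then all letters are enumerated and both sides are signed
    values of [g]. *)
Ltac local_check :=
  rewrite /move_op /psi_move /y_move /=;
  have := C_sparse (k := 0); have := C_sparse (k := 1);
  have := C_sparse (k := 2); have := C_sparse (k := 3);
  have := C_sparse (k := 4);
  case: (C 0); case: (C 1); case: (C 2); case: (C 3); case: (C 4); case: (C 5);
  do 5 (first [by move/(_ isT) | move=> _]);
  repeat match goal with b : bool |- _ => case: b end;
  rewrite /= ?opprK ?oppr0 ?addr0 ?add0r ?subr0 //;
  rewrite ?subrr ?addNr //.

Lemma local_yy1 g b0 b1 b2 b3 : let l := [:: b0; b1; b2; b3] in
  lop (y_move C 0) (lop (y_move C 1) g) l =
  lop (y_move C 1) (lop (y_move C 0) g) l.
Proof. by local_check. Qed.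

Lemma local_yy2 g b0 b1 b2 b3 b4 : let l := [:: b0; b1; b2; b3; b4] in
  lop (y_move C 0) (lop (y_move C 2) g) l =
  lop (y_move C 2) (lop (y_move C 0) g) l.
Proof. by local_check. Qed.

Lemma local_psiy2 g b0 b1 b2 b3 b4 : let l := [:: b0; b1; b2; b3; b4] in
  lop (psi_move C 0) (lop (y_move C 2) g) l =
  lop (y_move C 2) (lop (psi_move C 0) g) l.
Proof. by local_check. Qed.

Lemma local_psiy3 g b0 b1 b2 b3 b4 b5 : let l := [:: b0; b1; b2; b3; b4; b5] in
  lop (psi_move C 0) (lop (y_move C 3) g) l =
  lop (y_move C 3) (lop (psi_move C 0) g) l.
Proof. by local_check. Qed.

Lemma local_ypsi1 g b0 b1 b2 b3 b4 : let l := [:: b0; b1; b2; b3; b4] in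
  lop (psi_move C 1) (lop (y_move C 0) g) l =
  lop (y_move C 0) (lop (psi_move C 1) g) l.
Proof. by local_check. Qed.

Lemma local_ypsi2 g b0 b1 b2 b3 b4 b5 : let l := [:: b0; b1; b2; b3; b4; b5] in
  lop (psi_move C 2) (lop (y_move C 0) g) l =
  lop (y_move C 0) (lop (psi_move C 2) g) l.
Proof. by local_check. Qed.

Lemma local_psipsi2 g b0 b1 b2 b3 b4 b5 : let l := [:: b0; b1; b2; b3; b4; b5] in
  lop (psi_move C 0) (lop (psi_move C 2) g) l =
  lop (psi_move C 2) (lop (psi_move C 0) g) l.
Proof. by local_check. Qed.

Lemma local_psipsi3 g b0 b1 b2 b3 b4 b5 b6 :
  let l := [:: b0; b1; b2; b3; b4; b5; b6] in
  lop (psi_move C 0) (lop (psi_move C 3) g) l =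
  lop (psi_move C 3) (lop (psi_move C 0) g) l.
Proof. by local_check. Qed.

Lemma local_psi_yS g b0 b1 b2 b3 : let l := [:: b0; b1; b2; b3] in
  lop (psi_move C 0) (lop (y_move C 1) g) l =
  lop (y_move C 0) (lop (psi_move C 0) g) l +
  (if C 1%N && (b1 != b2) then g l else 0).
Proof. by local_check. Qed.

Lemma local_yS_psi g b0 b1 b2 b3 : let l := [:: b0; b1; b2; b3] in
  lop (y_move C 1) (lop (psi_move C 0) g) l =
  lop (psi_move C 0) (lop (y_move C 0) g) l +
  (if C 1%N && (b1 != b2) then g l else 0).
Proof. by local_check. Qed.

(** The cases are those of the relation for the square of [psi], read off from letters: like
    neighbours have adjacent residues, unlike ones have equal residues at a marked position and
    adjacent residues next to one. The third test decides the direction of the arrow; it is matched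
    with residues in [wres_eqS1]. *)
Lemma local_psi2 g b0 b1 b2 b3 : let l := [:: b0; b1; b2; b3] in
  lop (psi_move C 0) (lop (psi_move C 0) g) l =
  if (b1 != b2) && C 1%N then 0
  else if (b1 != b2) && ~~ (C 0 || C 2) then g l
  else if (if b1 == b2 then ~~ b1 else b1 (+) C 2%N)
  then lop (y_move C 1) g l - lop (y_move C 0) g l
  else lop (y_move C 0) g l - lop (y_move C 1) g l.
Proof. by local_check. Qed.

(** The two configurations with a correction are those in which the outer residues agree, see
    [wres_eqSS]; the last letter gives the sign. *)
Lemma local_braid g b0 b1 b2 b3 b4 : let l := [:: b0; b1; b2; b3; b4] in
  lop (psi_move C 0) (lop (psi_move C 1) (lop (psi_move C 0) g)) l =
  lop (psi_move C 1) (lop (psi_move C 0) (lop (psi_move C 1) g)) l +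
  sgn_opt (if C 1%N && (b1 == b2) && (b2 != b3) then Some b3 else
           if C 2%N && (b1 != b2) && (b2 == b3) then Some b3 else None) (g l).
Proof. by local_check. Qed.

End LocalChecks.

(** * The relations at arbitrary positions *)

Section WordRelations.
Variables (V : zmodType) (C : nat -> bool).
Hypothesis C_sparse : forall k, C k -> ~~ C k.+1 && ~~ C k.+2.

Local Notation wop := (@move_op V word id swap).
Local Notation lop := (@move_op V (seq bool) (nth false) lswap).
Local Notation psi q := (wop (psi_move C q)).
Local Notation y q := (wop (y_move C q)).
Implicit Types (f : word -> V) (w : word).

Let C_sparse_shift s k : (C \o addn s) k ->
  ~~ (C \o addn s) k.+1 && ~~ (C \o addn s) k.+2.
Proof. by rewrite /= !addnS; apply: C_sparse. Qed.

Definition window_at s k w : seq bool := mkseq (fun i => w (s + i)%N) k.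

Let window_eq s k w f g : window_ext s k w f g ->
  f w = g (window_at s k w).
Proof. by move=> /(_ (window_at s k w)); rewrite put_id size_mkseq; apply. Qed.

(** Recursion on the composite operator builds the proof that it acts inside the window; each [isT]
    certifies by computation that the window is wide enough. *)
Ltac window_op s k w f :=
  lazymatch f with
  | wop (psi_move C (s + ?q)) ?g =>
      let h := window_op s k w g in
      constr:(@window_psi V C s k w _ _ q isT h)
  | wop (y_move C (s + ?q)) ?g =>
      let h := window_op s k w g in
      constr:(@window_y V C s k w _ _ q isT h)
  | _ => constr:(@window_refl V s k w f)
  end.

Ltac to_window s k w :=
  repeat match goal with
  | |- context [wop ?m ?f w] =>
    let h := window_op s k w (wop m f) in
    rewrite (window_eq h)
  end.


Ltac window_check s k w lem :=
  to_window s k w; rewrite /window_at /mkseq [iota _ _]/= [map _ _]/=;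
  exact: (lem _ _ (@C_sparse_shift s)).

Lemma word_yy1 q f w : y q (y q.+1 f) w = y q.+1 (y q f) w.
Proof. rewrite -[q]addn0 -addnS; window_check q 4%N w local_yy1. Qed.

Lemma word_yy2 q f w : y q (y q.+2 f) w = y q.+2 (y q f) w.
Proof. rewrite -[q]addn0 -!addnS; window_check q 5%N w local_yy2. Qed.

Lemma word_psiy2 q f w : psi q (y q.+2 f) w = y q.+2 (psi q f) w.
Proof. rewrite -[q]addn0 -!addnS; window_check q 5%N w local_psiy2. Qed.

Lemma word_psiy3 q f w : psi q (y q.+3 f) w = y q.+3 (psi q f) w.
Proof. rewrite -[q]addn0 -!addnS; window_check q 6%N w local_psiy3. Qed.

Lemma word_ypsi1 q f w : psi q.+1 (y q f) w = y q (psi q.+1 f) w.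
Proof. rewrite -[q]addn0 -!addnS; window_check q 5%N w local_ypsi1. Qed.

Lemma word_ypsi2 q f w : psi q.+2 (y q f) w = y q (psi q.+2 f) w.
Proof. rewrite -[q]addn0 -!addnS; window_check q 6%N w local_ypsi2. Qed.

Lemma word_psipsi2 q f w : psi q (psi q.+2 f) w = psi q.+2 (psi q f) w.
Proof. rewrite -[q]addn0 -!addnS; window_check q 6%N w local_psipsi2. Qed.

Lemma word_psipsi3 q f w : psi q (psi q.+3 f) w = psi q.+3 (psi q f) w.
Proof. rewrite -[q]addn0 -!addnS; window_check q 7%N w local_psipsi3. Qed.

Lemma word_psi_yS q f w : psi q (y q.+1 f) w =
  y q (psi q f) w + (if C q.+1 && (w q.+1 != w q.+2) then f w else 0).
Proof.
rewrite -[q]addn0 -!addnS [f w](window_eq (@window_refl V q 4 w f)).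
window_check q 4%N w local_psi_yS.
Qed.

Lemma word_yS_psi q f w : y q.+1 (psi q f) w =
  psi q (y q f) w + (if C q.+1 && (w q.+1 != w q.+2) then f w else 0).
Proof.
rewrite -[q]addn0 -!addnS [f w](window_eq (@window_refl V q 4 w f)).
window_check q 4%N w local_yS_psi.
Qed.

Lemma word_psi2 q f w : psi q (psi q f) w =
  if (w q.+1 != w q.+2) && C q.+1 then 0
  else if (w q.+1 != w q.+2) && ~~ (C q || C q.+2) then f w
  else if (if w q.+1 == w q.+2 then ~~ w q.+1 else w q.+1 (+) C q.+2)
  then y q.+1 f w - y q f w
  else y q f w - y q.+1 f w.
Proof.
rewrite -[q]addn0 -!addnS [f w](window_eq (@window_refl V q 4 w f)).
window_check q 4%N w local_psi2.
Qed.

Lemma word_braid q f w : psi q (psi q.+1 (psi q f)) w =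
  psi q.+1 (psi q (psi q.+1 f)) w +
  sgn_opt (if C q.+1 && (w q.+1 == w q.+2) && (w q.+2 != w q.+3)
           then Some (w q.+3)
           else if C q.+2 && (w q.+1 != w q.+2) && (w q.+2 == w q.+3)
           then Some (w q.+3) else None) (f w).
Proof.
rewrite -[q]addn0 -!addnS [f w](window_eq (@window_refl V q 5 w f)).
window_check q 5%N w local_braid.
Qed.

Definition local_move q k (mv : (nat -> bool) -> move) :=
  (forall g g', (forall j, (q <= j < q + k)%N -> g j = g' j) -> mv g = mv g') /\
  (forall g, let: (_, x, y) := mv g in
     (q <= x < q + k)%N && (q <= y < q + k)%N).

(** The two exchanged letters and one more on each side, which the exchanges at distance 2 read or
    move. *)
Lemma psi_move_local q : local_move q 4 (psi_move C q).
Proof.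
split=> [g g' h|g]; rewrite /psi_move.
  by rewrite !h //; lia.
by do !case: ifP => _ /=; lia.
Qed.

Lemma y_move_local q : local_move q 3 (y_move C q).
Proof.
split=> [g g' h|g]; rewrite /y_move.
  by rewrite !h //; lia.
by do !case: ifP => _ /=; lia.
Qed.

Lemma swapE x y w k : k != x -> k != y -> swap x y w k = w k.
Proof. by rewrite /swap => /negbTE-> /negbTE->. Qed.

Lemma swap_comm x y x' y' w : x != x' -> x != y' -> y != x' -> y != y' ->
  swap x y (swap x' y' w) = swap x' y' (swap x y w).
Proof.
move=> h1 h2 h3 h4; apply: funext => k; rewrite /swap.
rewrite [x' == x]eq_sym [x' == y]eq_sym [y' == x]eq_sym [y' == y]eq_sym.
rewrite (negbTE h1) (negbTE h2) (negbTE h3) (negbTE h4).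
have [->|_] := eqVneq k x; first by rewrite (negbTE h1) (negbTE h2).
by have [->|//] := eqVneq k y; rewrite (negbTE h3) (negbTE h4).
Qed.

(** Neither move alters a letter that the other reads. Only overlapping supports require a finite
    check, whence the separate treatment of small distances below. *)
Lemma far_comm q k q' k' mv mv' f w : local_move q k mv -> local_move q' k' mv' ->
  (q + k <= q')%N -> wop mv (wop mv' f) w = wop mv' (wop mv f) w.
Proof.
move=> [ext in1] [ext' in2] qq'.
have := in1 w; have := in2 w; rewrite /move_op.
case e1: (mv w) => [[o x] y]; case e2: (mv' w) => [[o' x'] y'].
move=> hx' hx.
have -> : mv' (swap x y w) = mv' w.
  by apply: ext' => j hj; rewrite swapE //; lia.
have -> : mv (swap x' y' w) = mv w.
  by apply: ext => j hj; rewrite swapE //; lia.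
rewrite e1 e2 swap_comm; [|lia..].
by case: o e1 => [[]|] _; case: o' e2 => [[]|] _ //=; rewrite ?oppr0.
Qed.

Lemma word_yy q q' f w : y q (y q' f) w = y q' (y q f) w.
Proof.
wlog qq' : q q' / (q <= q')%N.
  by move=> h; case: (leqP q q') => [/h //|/ltnW/h ->].
have [->//|ne] := eqVneq q' q.
have [->|ne1] := eqVneq q' q.+1; first exact: word_yy1.
have [->|ne2] := eqVneq q' q.+2; first exact: word_yy2.
by apply: far_comm (y_move_local _) (y_move_local _) _; lia.
Qed.

Lemma word_psiy q q' f w : q' != q -> q' != q.+1 ->
  psi q (y q' f) w = y q' (psi q f) w.
Proof.
move=> n0 n1.
have [->|ne2] := eqVneq q' q.+2; first exact: word_psiy2.
have [->|ne3] := eqVneq q' q.+3; first exact: word_psiy3.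
have [->|ne4] := eqVneq q q'.+1; first exact: word_ypsi1.
have [->|ne5] := eqVneq q q'.+2; first exact: word_ypsi2.
have [h|h] := leqP q q'.
  by apply: far_comm (psi_move_local _) (y_move_local _) _; lia.
by apply/esym; apply: far_comm (y_move_local _) (psi_move_local _) _; lia.
Qed.

Lemma word_psipsi q q' f w : (q.+1 < q')%N || (q'.+1 < q)%N ->
  psi q (psi q' f) w = psi q' (psi q f) w.
Proof.
wlog qq' : q q' / (q <= q')%N.
  move=> h; case: (leqP q q') => [/h //|/ltnW qq' h'].
  by apply/esym/h; rewrite // orbC.
move=> h; have [->|ne2] := eqVneq q' q.+2; first exact: word_psipsi2.
have [->|ne3] := eqVneq q' q.+3; first exact: word_psipsi3.
by apply: far_comm (psi_move_local _) (psi_move_local _) _; lia.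
Qed.

End WordRelations.

(** * Residues of words *)

Lemma swapK x y : involutive (swap x y).
Proof.
move=> w; apply: funext => k; rewrite /swap !eqxx.
by have [->|_] := eqVneq k x; [case: eqP => [->|] | case: eqP => [->|]].
Qed.

Implicit Type w : word.

Definition legs w (q : nat) : nat := (\sum_(0 <= j < q) w j.+1)%N.

Lemma legsS w q : legs w q.+1 = (legs w q + w q.+1)%N.
Proof. by rewrite /legs big_nat_recr. Qed.

Lemma legs_swap x y w k : (x < y)%N -> w x.+1 -> ~~ w y.+1 ->
  legs w k = (legs (swap x.+1 y.+1 w) k + (x < k <= y))%N.
Proof.
move=> xy wx wy; elim: k => [|k ih]; first by rewrite /legs !big_geq.
rewrite !legsS {}ih {3}/swap !eqSS wx (negbTE wy).
have [->|kx] := eqVneq k x; first by rewrite wx; lia.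
have [->|ky] := eqVneq k y; first by rewrite (negbTE wy); lia.
by case: (w k.+1); lia.
Qed.

Definition transp (q k : nat) : nat :=
  if k == q then q.+1 else if k == q.+1 then q else k.

Lemma transpK q : involutive (transp q).
Proof.
move=> k; rewrite /transp.
by do !case: eqP => //; lia.
Qed.

Section WordResidues.
Variables (e : nat) (kappa : 'Z_e * 'Z_e).

(** Residue of the letter at position [q.+1]: along the leg residues fall from [kappa.2], along the
    arm they rise from [kappa.1], and [q - legs w q] arm letters precede. *)
Definition wres w (q : nat) : 'Z_e :=
  if w q.+1 then kappa.2 - (legs w q)%:R else kappa.1 + q%:R - (legs w q)%:R.

Let wres_swap2LA w q k : w q.+1 -> ~~ w q.+2 ->
  wres (swap q.+1 q.+2 w) k = wres w (transp q k).
Proof.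
move=> wL wA; have lE j := legs_swap j (ltnSn q) wL wA.
have l1 := legsS w q; rewrite wL addn1 in l1.
have l0 : legs (swap q.+1 q.+2 w) q = legs w q by have := lE q; lia.
have l0' : legs (swap q.+1 q.+2 w) q.+1 = legs w q by have := lE q.+1; lia.
rewrite /wres /transp; have [->|kq] := eqVneq k q.
  by rewrite {1}/swap eqxx (negbTE wA) l0 l1 -!natr1; ring.
have [->|kq1] := eqVneq k q.+1.
  by rewrite {1}/swap eqxx gtn_eqF ?ltnS // wL l0'.
rewrite {1}/swap !eqSS (negbTE kq) (negbTE kq1).
have h : (q < k <= q.+1)%N = false by lia.
by rewrite (lE k) h addn0.
Qed.

(** Exchanging unlike neighbours preserves the order within the leg and within the arm, so every
    letter carries its residue along. *)
Lemma wres_swap2 w q k : w q.+1 != w q.+2 ->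
  wres (swap q.+1 q.+2 w) k = wres w (transp q k).
Proof.
case w1: (w q.+1); case w2: (w q.+2) => // _; first by apply: wres_swap2LA; rewrite ?w1 ?w2.
rewrite -{2}[w](swapK q.+1 q.+2) [RHS]wres_swap2LA ?transpK //.
  by rewrite /swap eqxx.
by rewrite /swap gtn_eqF // eqxx w1.
Qed.


End WordResidues.

Section Residues.
Variables (e n : nat) (kappa : 'Z_e * 'Z_e).
Hypotheses (e_gt2 : (2 < e)%N) (n_kappa : n%:R = kappa.2 - kappa.1 + 1)
  (n_neq0 : n%:R != 0 :> 'Z_e).

(* The positions at which a leg and an arm have the same residue. *)
Definition critical (r : nat) : bool := r%:R == n%:R :> 'Z_e.

Local Notation wres := (wres kappa).

Let Zp1 : (1 : 'Z_e) != 0. Proof. exact: oner_neq0. Qed.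

Let Zp2 : (2%:R : 'Z_e) != 0.
Proof.
apply/eqP => h; have := val_Zp_nat (ltnW e_gt2) 2.
by rewrite h modn_small.
Qed.

Let eq_addl (a b : 'Z_e) : (a + b == a) = (b == 0).
Proof. by rewrite -[X in _ == X]addr0 (inj_eq (addrI _)). Qed.

Lemma critical_sparse k : critical k -> ~~ critical k.+1 && ~~ critical k.+2.
Proof.
rewrite /critical => /eqP <-; rewrite -[k.+2]addn2 -[k.+1]addn1 !natrD.
by rewrite !eq_addl mulr1n Zp1 Zp2.
Qed.

Let kappa2 : kappa.2 = n%:R + kappa.1 - 1. Proof. by rewrite n_kappa; ring. Qed.

Let criticalE q : critical q.+1 -> n%:R = q%:R + 1 :> 'Z_e.
Proof. by move/eqP <-; rewrite -natr1. Qed.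

Let swap3_legs w q : w q.+1 -> ~~ w q.+3 ->
  let w' := swap q.+1 q.+3 w in
  [/\ legs w' q = legs w q, legs w' q.+1 = legs w q,
      legs w' q.+2 = (legs w q + w q.+2)%N
    & forall k, k != q -> k != q.+1 -> k != q.+2 -> legs w' k = legs w k].
Proof.
move=> wL wA w'.
have lE j : legs w j = (legs w' j + (q < j <= q.+2))%N by apply: legs_swap; lia.
have l1 := legsS w q; have l2 := legsS w q.+1; rewrite wL addn1 in l1.
have := lE q; have := lE q.+1; have := lE q.+2; split; try lia.
by move=> k; have := lE k; lia.
Qed.

(** The exchange at distance 2 amounts to two neighbour exchanges, one of which, at [q.+2] and
    [q.+3], concerns a leg and an arm of equal residue and is invisible on residues. Which of the
    two comes first depends on the middle letter. *)
Lemma wres_swap3l w q k : w q.+1 -> ~~ w q.+3 -> critical q.+2 ->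
  wres (swap q.+1 q.+3 w) k = wres w (transp q k).
Proof.
move=> wL wA /criticalE nE; have [l0 l1 l2 lk] := swap3_legs wL wA.
have h1 := legsS w q; have h2 := legsS w q.+1.
rewrite wL addn1 in h1; rewrite h1 in h2.
rewrite /wres kappa2 nE /transp.
have [->|kq] := eqVneq k q.
  rewrite {1}/swap eqxx (negbTE wA) l0 h1.
  by case: (w q.+2); rewrite ?addn0 ?addn1 -!natr1; ring.
have [->|kq1] := eqVneq k q.+1.
  rewrite {1}/swap !eqSS gtn_eqF // ltn_eqF // wL l1.
  by case: (w q.+2); rewrite ?addn0 ?addn1 -!natr1; ring.
have [->|kq2] := eqVneq k q.+2.
  rewrite {1}/swap eqxx gtn_eqF ?ltnS // wL (negbTE wA) l2 h2.
  by rewrite !natrD -?natr1; ring.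
by rewrite /swap !eqSS (negbTE kq) (negbTE kq2) lk.
Qed.

(** The mirror image: now the invisible exchange is the one at [q.+1] and [q.+2]. *)
Lemma wres_swap3r w q k : w q.+1 -> ~~ w q.+3 -> critical q.+1 ->
  wres (swap q.+1 q.+3 w) k = wres w (transp q.+1 k).
Proof.
move=> wL wA /criticalE nE; have [l0 l1 l2 lk] := swap3_legs wL wA.
have h1 := legsS w q; have h2 := legsS w q.+1.
rewrite wL addn1 in h1; rewrite h1 in h2.
rewrite /wres kappa2 nE /transp.
have [->|kq1] := eqVneq k q.+1.
  rewrite {1}/swap !eqSS gtn_eqF // ltn_eqF // (negbTE wA) l1 h2.
  by case: (w q.+2); rewrite ?addn0 ?addn1 -!natr1; ring.
have [->|kq2] := eqVneq k q.+2.
  rewrite {1}/swap eqxx gtn_eqF ?ltnS // wL l2 h1.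
  by case: (w q.+2); rewrite ?addn0 ?addn1 -!natr1; ring.
have [->|kq] := eqVneq k q.
  by rewrite {1}/swap eqxx wL (negbTE wA) l0; ring.
by rewrite /swap !eqSS (negbTE kq) (negbTE kq2) lk.
Qed.

Lemma wres_psi_move w q k : let: (o, x, y) := psi_move critical q w in
  o != None -> wres (swap x y w) k = wres w (transp q k).
Proof.
rewrite /psi_move; case: ifP => [/andP[h1 h2] _|_].
  by apply: wres_swap2; rewrite h2; case: (w _) h1.
case: ifP => // _; case: ifP => c2.
  by case: ifP => // /andP[h1 h2] _; apply: wres_swap3l.
case: ifP => c0; last first.
  by case: ifP => // /andP[h1 h2] _; apply: wres_swap2; rewrite h1.
case: ifP => // /andP[h1 h2] _.
(* For [q = 0] position 0 would be critical, against [n_neq0]; thus the padding letter is never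
   moved. *)
case: q c0 h1 h2 {c2} => [|q] c0; last by move=> h1 h2; apply: wres_swap3r.
by move: c0 n_neq0; rewrite /critical eq_sym => ->.
Qed.

(** The only letters that [y] exchanges are unlike neighbours at a critical position, whose residues
    agree. *)
Lemma wres_y_move w q k : let: (o, x, y) := y_move critical q w in
  o != None -> wres (swap x y w) k = wres w k.
Proof.
have main p : critical p.+1 -> w p.+1 -> ~~ w p.+2 ->
    wres (swap p.+1 p.+2 w) k = wres w k.
  move=> /criticalE nE wL wA; rewrite wres_swap2 ?wL //.
  have : wres w p = wres w p.+1.
    rewrite /wres wL (negbTE wA) legsS wL addn1 kappa2 nE.
    by rewrite -!natr1; ring.
  by rewrite /transp; case: eqP => [->|_] //; case: eqP => [->|].
rewrite /y_move; case: ifP => [/and3P[c1 h1 h2] _|_]; first exact: main.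
case: ifP => // /and3P[c0 h1 h2] _.
case: q c0 h1 h2 => [|q] c0; last exact: main.
by move: c0 n_neq0; rewrite /critical eq_sym => ->.
Qed.

(** Unlike neighbours differ by plus or minus [q + 1 - n], which vanishes exactly when [q.+1] is
    critical; all comparisons of residues below follow from this formula. *)
Lemma wresS w q : wres w q.+1 = wres w q +
  (if w q.+1 then (if w q.+2 then -1 else q%:R + 1 - n%:R)
   else if w q.+2 then n%:R - q%:R - 1 else 1).
Proof.
rewrite /wres legsS kappa2; case: (w q.+1); case: (w q.+2);
 by rewrite ?addn0 ?addn1 -?natr1; ring.
Qed.

Let wresSS w q : wres w q.+2 = wres w q +
  (if w q.+1 then
     if w q.+2 then (if w q.+3 then -2%:R else q%:R + 1 - n%:R)
     else (if w q.+3 then -1 else q%:R + 2%:R - n%:R)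
   else
     if w q.+2 then (if w q.+3 then n%:R - q%:R - 2%:R else 1)
     else (if w q.+3 then n%:R - q%:R - 1 else 2%:R)).
Proof.
rewrite !wresS; case: (w q.+1); case: (w q.+2); case: (w q.+3);
 by rewrite -?[q.+1]addn1 ?natrD; ring.
Qed.

Let critical0 q : critical q = (q%:R - n%:R == 0 :> 'Z_e).
Proof. by rewrite subr_eq0. Qed.

Let critical1 q : critical q.+1 = (q%:R + 1 - n%:R == 0 :> 'Z_e).
Proof. by rewrite critical0 -natr1. Qed.

Let critical2 q : critical q.+2 = (q%:R + 2%:R - n%:R == 0 :> 'Z_e).
Proof. by rewrite critical0 -natrD addn2. Qed.

Lemma wres_eqS w q :
  (wres w q == wres w q.+1) = critical q.+1 && (w q.+1 != w q.+2).
Proof.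
rewrite eq_sym wresS eq_addl critical1.
case: (w q.+1); case: (w q.+2); rewrite ?andbF ?andbT ?oppr_eq0 ?(negbTE Zp1) //.
by rewrite -oppr_eq0; congr (_ == _); ring.
Qed.

Lemma wres_eqSS w q : (wres w q.+2 == wres w q) =
  if w q.+1 == w q.+2 then critical q.+1 && (w q.+2 != w q.+3)
  else critical q.+2 && (w q.+2 == w q.+3).
Proof.
rewrite wresSS eq_addl critical1 critical2.
case: (w _); case: (w _); case: (w _);
  rewrite ?andbF ?andbT ?oppr_eq0 ?(negbTE Zp1) ?(negbTE Zp2) //=.
  by rewrite -oppr_eq0; congr (_ == _); ring.
by rewrite -oppr_eq0; congr (_ == _); ring.
Qed.

Lemma wres_eqS1 w q : (wres w q.+1 == wres w q + 1) =
  if w q.+1 == w q.+2 then ~~ w q.+1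
  else if w q.+1 then critical q else critical q.+2.
Proof.
rewrite wresS (inj_eq (addrI _)) -subr_eq0 critical2 critical0.
case: (w _); case: (w _) => /=.
- by rewrite -opprD oppr_eq0 (negbTE Zp2).
- by congr (_ == _); ring.
- by rewrite -oppr_eq0; congr (_ == _); ring.
- by rewrite subrr eqxx.
Qed.

Lemma wres_eqSN1 w q : (wres w q.+1 == wres w q - 1) =
  if w q.+1 == w q.+2 then w q.+1
  else if w q.+1 then critical q.+2 else critical q.
Proof.
rewrite wresS (inj_eq (addrI _)) -subr_eq0 opprK critical2 critical0.
case: (w _); case: (w _) => /=.
- by rewrite addNr eqxx.
- by congr (_ == _); ring.
- by rewrite -oppr_eq0; congr (_ == _); ring.
- by rewrite (negbTE Zp2).
Qed.

Definition word_res (w : word) : n.-tuple 'Z_e := [tuple wres w k | k < n].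

Lemma res_word w q : (q < n)%N -> res (word_res w) q.+1 = wres w q.
Proof. by move=> qn; rewrite (res_tuple (wres w)). Qed.
End Residues.

(** * The module of functions on words *)

Lemma swap_resK e n r : (0 < r < n)%N -> involutive (@swap_res e n r).
Proof.
move=> hr i; apply: res_ext => s hs; rewrite res_swap // res_swap; last first.
  by do !case: eqP; lia.
by congr res; do !case: eqP; lia.
Qed.

(** * Actions on functions and their passage to quotient rings *)

Section QuotientAction.
Variables (F : fieldType) (T : Type).
Implicit Types (f g : T -> F).

(** Bare laws rather than a module structure, since the action is transported through two ring
    quotients by way of representatives. The linearity law makes operators fix the zero function, as
    two-sided ideals require. *)
Definition is_action (R : pzRingType) (act : R -> (T -> F) -> T -> F) :=
  [/\ forall x x' f t, act (x + x') f t = act x f t + act x' f t,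
      forall x x' f, act (x * x') f = act x (act x' f),
      forall f, act 1 f = f
    & forall x c f g t,
        act x (fun t => c * f t + g t) t = c * act x f t + act x g t].

Section Laws.
Variables (R : pzRingType) (act : R -> (T -> F) -> T -> F).
Hypothesis actP : is_action act.

Lemma act0 f t : act 0 f t = 0.
Proof.
have [actD _ _ _] := actP.
by apply: (addrI (act 0 f t)); rewrite -actD !addr0.
Qed.

Lemma actB x x' f t : act (x - x') f t = act x f t - act x' f t.
Proof.
have [actD _ _ _] := actP.
by apply/eqP; rewrite eq_sym subr_eq -actD subrK.
Qed.

Lemma act_zero x : act x (fun=> 0) = fun=> 0.
Proof.
have [_ _ _ actL] := actP; apply: funext => t.
have := actL x 1 (fun=> 0) (fun=> 0) t; rewrite mul1r addr0 mul1r => h.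
by apply: (addrI (act x (fun=> 0) t)); rewrite -h addr0.
Qed.

Lemma act_ideal (rel : R -> R -> Prop) x f :
  (forall x x' f, rel x x' -> act x f = act x' f) ->
  ideal_gen rel x -> act x f = fun=> 0.
Proof.
have [actD actM _ _] := actP.
move=> hrel h; elim: h f => {x} [x y h||x y _ hx _ hy|a x _ ih|a x _ ih] f.
- by apply: funext => t; rewrite actB (hrel _ _ _ h) subrr.
- by apply: funext => t; rewrite act0.
- by apply: funext => t; rewrite actD hx hy addr0.
- by rewrite actM ih act_zero.
- by rewrite actM ih.
Qed.

Variable rel : R -> R -> Prop.
Hypothesis act_rel : forall x x' f, rel x x' -> act x f = act x' f.

Definition quot_act (x : ring_quot rel) f : T -> F := act (repr x) f.

Lemma quot_actE x f : quot_act (ring_proj rel x) f = act x f.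
Proof.
have h : ideal_gen rel (repr (ring_proj rel x) - x).
  by apply/ring_projP; rewrite ring_projK.
apply: funext => t; apply/eqP; rewrite -subr_eq0 -actB.
by rewrite (act_ideal _ act_rel h).
Qed.

End Laws.

Lemma quot_act_action (R : pzRingType) (act : R -> (T -> F) -> T -> F)
    (rel : R -> R -> Prop) : is_action act ->
  (forall x x' f, rel x x' -> act x f = act x' f) ->
  is_action (@quot_act R act rel).
Proof.
move=> actP act_rel; have E := @quot_actE _ _ actP _ act_rel.
have [actD actM act1 actL] := actP.
split=> [x x' f t|x x' f|f|x c f g t].
- by rewrite -[x]ring_projK -[x']ring_projK -raddfD !E actD.
- by rewrite -[x]ring_projK -[x']ring_projK -rmorphM !E actM.
- by rewrite -(rmorph1 (ring_proj rel)) E act1.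
- exact: actL.
Qed.

End QuotientAction.

Section WordAction.
Variables (F : fieldType) (e n : nat) (kappa : 'Z_e * 'Z_e).
Hypotheses (e_gt2 : (2 < e)%N) (n_kappa : n%:R = kappa.2 - kappa.1 + 1)
  (n_neq0 : n%:R != 0 :> 'Z_e).

Local Notation wfun := (word -> F).
Local Notation wop := (@move_op F word id swap).
Local Notation wR := (word_res n kappa).

Definition e_op (i : n.-tuple 'Z_e) (f : wfun) : wfun :=
  fun w => if wR w == i then f w else 0.
Definition psi_op (r : nat) (f : wfun) : wfun := wop (psi_move (@critical e n) r.-1) f.
Definition y_op (r : nat) (f : wfun) : wfun := wop (y_move (@critical e n) r.-1) f.

Lemma e_opM i j f : e_op i (e_op j f) = if i == j then e_op i f else fun=> 0.
Proof.
apply: funext => w; rewrite /e_op; case: (eqVneq i j) => [->|ij].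
  by case: eqP.
by case: eqP => // ->; rewrite (negbTE ij).
Qed.

Lemma psi_e_op r i f : (0 < r < n)%N ->
  psi_op r (e_op i f) = e_op (swap_res r i) (psi_op r f).
Proof.
case: r => // q /= qn; apply: funext => w; rewrite /psi_op /e_op /move_op /=.
have := fun k => wres_psi_move e_gt2 n_kappa n_neq0 w q k.
case: (psi_move _ _ _) => [[o x] y] h.
case: o h => [b|] h /=; last by case: ifP.
have -> : wR (swap x y w) = swap_res q.+1 (wR w).
  apply: res_ext => -[//|k] /= kn; rewrite res_word // h // /transp res_swap //.
  rewrite !eqSS; have [kq|kq] := eqVneq k q; first by rewrite res_word.
  by have [kq1|kq1] := eqVneq k q.+1; rewrite res_word //; lia.
have K := @swap_resK e n q.+1 qn; rewrite (can2_eq K K).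
by case: b {h}; case: ifP => //; rewrite oppr0.
Qed.

Lemma y_e_op r i f : (0 < r <= n)%N ->
  y_op r (e_op i f) = e_op i (y_op r f).
Proof.
case: r => // q /= qn; apply: funext => w; rewrite /y_op /e_op /move_op /=.
have := fun k => wres_y_move n_kappa n_neq0 w q k.
case: (y_move _ _ _) => [[o x] y] h.
case: o h => [b|] h /=; last by case: ifP.
have -> : wR (swap x y w) = wR w.
  by apply: res_ext => -[//|k] /= kn; rewrite !res_word // h.
by case: b {h}; case: ifP => //; rewrite oppr0.
Qed.


Let C_sparse k : critical e n k -> ~~ critical e n k.+1 && ~~ critical e n k.+2.
Proof. exact: critical_sparse. Qed.

Let delta_eq q i f w : (q.+1 < n)%N ->
  (if critical e n q.+1 && (w q.+1 != w q.+2) then e_op i f w else 0) =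
  (res i q.+1 == res i q.+2)%:R * e_op i f w.
Proof.
move=> qn; rewrite /e_op; case: (wR w =P i) => [<-|_]; last by rewrite mulr0 if_same.
rewrite !res_word ?(ltnW qn) // (wres_eqS n_kappa).
by case: ifP; rewrite ?mul1r ?mul0r.
Qed.


(** * The defining relations as identities of operators on functions of words *)

Section Relations.
Variables (R : pzRingType) (act : R -> wfun -> wfun) (actP : is_action act).
Variables (E : n.-tuple 'Z_e -> R) (y psi : nat -> R).
Hypothesis act_e : forall i f, act (E i) f = e_op i f.
Hypothesis act_y : forall r f, (0 < r <= n)%N -> act (y r) f = y_op r f.
Hypothesis act_psi : forall r f, (0 < r < n)%N -> act (psi r) f = psi_op r f.

Let actD x x' f w : act (x + x') f w = act x f w + act x' f w.
Proof. by have [] := actP. Qed.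

Let actM x x' f : act (x * x') f = act x (act x' f).
Proof. by have [] := actP. Qed.

Let act1 f : act 1 f = f. Proof. by have [] := actP. Qed.

Lemma act_sum (I : Type) (r : seq I) (P : pred I) (x : I -> R) f w :
  act (\sum_(i <- r | P i) x i) f w = \sum_(i <- r | P i) act (x i) f w.
Proof.
by apply: (big_morph (fun x => act x f w)) => [? ?|]; rewrite ?actD ?act0.
Qed.

Let act_nat k f w : act k%:R f w = k%:R * f w.
Proof.
elim: k => [|k ih]; first by rewrite mul0r act0.
by rewrite -[k.+1%:R]natr1 actD ih act1 -natr1 mulrDl mul1r.
Qed.

Lemma act_ee i j f : act (E i * E j) f = act (if i == j then E i else 0) f.
Proof.
rewrite actM !act_e e_opM; case: eqP => _; first by rewrite act_e.
by apply: funext => w; rewrite act0.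
Qed.

Lemma act_e_sum f : act (\sum_i E i) f = act 1 f.
Proof.
rewrite act1; apply: funext => w; rewrite act_sum (bigD1 (wR w)) //=.
rewrite big1 => [|i iw]; rewrite act_e /e_op ?eqxx ?addr0 //.
by rewrite eq_sym (negbTE iw).
Qed.

Lemma act_ye r i f : (0 < r <= n)%N -> act (y r * E i) f = act (E i * y r) f.
Proof. by move=> hr; rewrite !actM !act_e !act_y // y_e_op. Qed.

Lemma act_psie r i f : (0 < r < n)%N ->
  act (psi r * E i) f = act (E (swap_res r i) * psi r) f.
Proof. by move=> hr; rewrite !actM !act_e !act_psi // psi_e_op. Qed.

Lemma act_yy r s f : (0 < r <= n)%N -> (0 < s <= n)%N ->
  act (y r * y s) f = act (y s * y r) f.
Proof.
move=> hr hs; rewrite !actM !act_y //.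
by apply: funext => w; apply: word_yy.
Qed.

Lemma act_psiy r s f : (0 < r < n)%N -> (0 < s <= n)%N -> s != r -> s != r.+1 ->
  act (psi r * y s) f = act (y s * psi r) f.
Proof.
move=> hr hs n1 n2; rewrite !actM !act_y // !act_psi //.
by apply: funext => w; apply: word_psiy => //; lia.
Qed.

Lemma act_psipsi r s f : (0 < r < n)%N -> (0 < s < n)%N ->
  ((r.+1 < s) || (s.+1 < r))%N -> act (psi r * psi s) f = act (psi s * psi r) f.
Proof.
move=> hr hs h; rewrite !actM !act_psi //.
by apply: funext => w; apply: word_psipsi => //; lia.
Qed.

Lemma act_psiyS r i f : (0 < r < n)%N ->
  act (psi r * y r.+1 * E i) f =
  act ((y r * psi r + (res i r == res i r.+1)%:R) * E i) f.
Proof.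
case: r => [//|q] hr; have hr1 : (0 < q.+1 <= n)%N by lia.
have hr2 : (0 < q.+2 <= n)%N by lia.
rewrite !actM act_e; apply: funext => w.
rewrite actD act_nat actM !act_psi // !act_y //.
by rewrite /psi_op /y_op /= word_psi_yS //; congr (_ + _); exact: delta_eq.
Qed.

Lemma act_ySpsi r i f : (0 < r < n)%N ->
  act (y r.+1 * psi r * E i) f =
  act ((psi r * y r + (res i r == res i r.+1)%:R) * E i) f.
Proof.
case: r => [//|q] hr; have hr1 : (0 < q.+1 <= n)%N by lia.
have hr2 : (0 < q.+2 <= n)%N by lia.
rewrite !actM act_e; apply: funext => w.
rewrite actD act_nat actM !act_psi // !act_y //.
by rewrite /psi_op /y_op /= word_yS_psi //; congr (_ + _); exact: delta_eq.
Qed.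

Lemma act_psi2 r i f : (0 < r < n)%N ->
  act (psi r ^+ 2 * E i) f =
  act (if res i r == res i r.+1 then 0
       else if res i r.+1 == res i r + 1 then (y r.+1 - y r) * E i
       else if res i r.+1 == res i r - 1 then (y r - y r.+1) * E i
       else E i) f.
Proof.
case: r => [//|q] hr; have hr1 : (0 < q.+1 <= n)%N by lia.
have hr2 : (0 < q.+2 <= n)%N by lia.
rewrite expr2 !actM act_e !act_psi //; apply: funext => w.
have eO (c1 c2 c3 : bool) : act
    (if c1 then 0 else if c2 then (y q.+2 - y q.+1) * E i
     else if c3 then (y q.+1 - y q.+2) * E i else E i) f w =
    if c1 then 0
    else if c2 then e_op i (y_op q.+2 f) w - e_op i (y_op q.+1 f) w
    else if c3 then e_op i (y_op q.+1 f) w - e_op i (y_op q.+2 f) w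
    else e_op i f w.
  rewrite -!y_e_op // -!act_y // -act_e.
  by case: c1; case: c2; case: c3; rewrite ?act0 ?actM ?actB.
(* Both sides are supported on the words with residue sequence [i]; on these the tests on residues
   turn into tests on letters and critical positions. *)
rewrite {}eO !psi_e_op // swap_resK // {1 2 3 4 5 6}/e_op.
case: (wR w =P i) => [<-|_]; last by do !case: ifP; rewrite ?subrr.
rewrite !res_word; [|lia..].
rewrite (wres_eqS n_kappa) (wres_eqS1 e_gt2 n_kappa) (wres_eqSN1 e_gt2 n_kappa).
rewrite /psi_op /y_op /= word_psi2 // [LHS]/=.
have := @C_sparse q; have := @C_sparse q.+1.
case: (critical e n q); case: (critical e n q.+1); case: (critical e n q.+2);
  case: (w q.+1); case: (w q.+2) => //=.
all: by do ?[by move/(_ isT) | move=> _].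
Qed.

Lemma act_braid r i f : (0 < r)%N -> (r.+1 < n)%N ->
  act (psi r * psi r.+1 * psi r * E i) f =
  act (let b := psi r.+1 * psi r * psi r.+1 in
       if (res i r.+2 == res i r) && (res i r.+1 == res i r + 1)
       then (b + 1) * E i
       else if (res i r.+2 == res i r) && (res i r.+1 == res i r - 1)
       then (b - 1) * E i
       else b * E i) f.
Proof.
case: r => [//|q] _ hr; have hr1 : (0 < q.+1 < n)%N by lia.
have hr2 : (0 < q.+2 < n)%N by lia.
apply: funext => w.
have eO (c1 c2 : bool) : act
    (let b := psi q.+2 * psi q.+1 * psi q.+2 in if c1 then (b + 1) * E i
     else if c2 then (b - 1) * E i else b * E i) f w =
    psi_op q.+2 (psi_op q.+1 (psi_op q.+2 (e_op i f))) w +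
    sgn_opt (if c1 then Some true else if c2 then Some false else None)
      (e_op i f w).
  rewrite -act_e -!act_psi // -!actM /=.
  case: c1 => /=; first by rewrite mulrDl mul1r actD ?mulrA.
  case: c2 => /=; first by rewrite mulrBl mul1r actB // ?mulrA.
  by rewrite addr0 ?mulrA.
rewrite {}eO !actM !act_e !act_psi //.
rewrite /psi_op /= word_braid //; congr (_ + _).
rewrite /e_op; case: (wR w =P i) => [<-|_]; last first.
  have sgn0 o : sgn_opt o (0 : F) = 0 by case: o => [[]|] //=; rewrite oppr0.
  by rewrite !sgn0.
congr sgn_opt; rewrite !res_word; [|lia..].
rewrite (wres_eqS1 e_gt2 n_kappa) (wres_eqSN1 e_gt2 n_kappa) (wres_eqSS e_gt2 n_kappa).
have := @C_sparse q; have := @C_sparse q.+1.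
case: (critical e n q); case: (critical e n q.+1); case: (critical e n q.+2);
  case: (w q.+1); case: (w q.+2); case: (w q.+3) => //=.
all: by do ?[by move/(_ isT) | move=> _].
Qed.

Hypothesis n_gt0 : (0 < n)%N.

Let critical0 : critical e n 0 = false.
Proof. by rewrite /critical eq_sym; apply: negbTE. Qed.

(** If position 1 is not critical, [y_1] acts by zero, and the exponent is positive because the
    first residue is [kappa.1] or [kappa.2]. If it is critical, then [kappa.1 = kappa.2], the
    exponent on the support is 2, and [y_1] squares to zero. *)
Lemma act_cyc i f :
  act (y 1%N ^+ cyc_mult kappa (res i 1%N) * E i) f = fun=> 0.
Proof.
rewrite actM act_e.
have y1 g w : y_op 1 g w = if [&& critical e n 1, w 1%N & ~~ w 2%N]
    then - g (swap 1 2 w) else 0.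
  by rewrite /y_op /move_op /y_move /= critical0 /=; case: ifP.
have y1y1 g w : y_op 1 (y_op 1 g) w = 0.
  rewrite !y1; case: ifP => // /and3P[_ _ w2].
  by rewrite /swap /= (negbTE w2) andbF oppr0.
have exp_act k g : act (y 1%N ^+ k) g = iter k (y_op 1) g.
  elim: k => [|k ih]; first by rewrite expr0 act1.
  by rewrite exprS actM ih iterS act_y ?n_gt0.
rewrite exp_act; apply: funext => w.
have -> k : iter k (y_op 1) (e_op i f) w = e_op i (iter k (y_op 1) f) w.
  suff -> : iter k (y_op 1) (e_op i f) = e_op i (iter k (y_op 1) f) by [].
  by elim: k => //= k ->; rewrite y_e_op.
rewrite /e_op; case: (wR w =P i) => // <-.
have -> : res (wR w) 1 = if w 1%N then kappa.2 else kappa.1.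
  rewrite res_word // /wres /legs big_geq //.
  by case: (w 1%N); rewrite subr0 ?addr0.
have [c1|c1] := boolP (critical e n 1).
  rewrite /cyc_mult; have -> : kappa.2 = kappa.1.
    move: c1; rewrite /critical n_kappa -subr_eq0 => /eqP h; apply/eqP.
    by rewrite -subr_eq0 -oppr_eq0; apply/eqP; rewrite -[RHS]h; ring.
  by rewrite if_same !eqxx; exact: y1y1.
have y0 g : y_op 1 g w = 0 by rewrite y1 (negbTE c1).
by rewrite /cyc_mult; case: (w 1%N); rewrite eqxx ?addn1 ?add1n /= y0.
Qed.

End Relations.

Definition gen_op (g : klr_gen e n) : wfun -> wfun :=
  match g with
  | GenE i => e_op i
  | GenY r => y_op (val r)
  | GenPsi r => psi_op (val r)
  end.

Definition mon_op (k : {fmonom klr_gen e n}) (f : wfun) : wfun := foldr gen_op f k.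

Definition free_act (x : klr_free F e n) (f : wfun) : wfun :=
  fun w => mmap idfun (fun k => mon_op k f w) x.

(** A monomial reads one value of its argument, at a word independent of [f]. This yields linearity
    in [f] and lets sums be pulled through in [free_actM]. *)
Lemma mon_opE k w : exists a w', forall f, mon_op k f w = a * f w'.
Proof.
rewrite /mon_op; elim: (fmonom_val k) w => [|g s ih] w /=.
  by exists 1, w => f; rewrite mul1r.
have [a [w' h]] : exists a w', forall f, gen_op g f w = a * f w'.
  case: g => [i|r|r] /=.
  - exists (wR w == i)%:R, w => f; rewrite /e_op.
    by case: eqP; rewrite ?mul1r ?mul0r.
  - rewrite /y_op /move_op; case: (y_move _ _ _) => [[o x] y].
    exists (sgn_opt o 1), (swap x y w) => f.
    by case: o => [[]|] /=; rewrite ?mul1r ?mulN1r ?mul0r.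
  - rewrite /psi_op /move_op; case: (psi_move _ _ _) => [[o x] y].
    exists (sgn_opt o 1), (swap x y w) => f.
    by case: o => [[]|] /=; rewrite ?mul1r ?mulN1r ?mul0r.
have [b [w'' h']] := ih w'.
by exists (a * b), w'' => f; rewrite h h' mulrA.
Qed.

Lemma free_actD x y f w : free_act (x + y) f w = free_act x f w + free_act y f w.
Proof. exact: mmapD. Qed.

Lemma free_act_sum (I : Type) (r : seq I) (P : pred I) (x : I -> klr_free F e n) f w :
  free_act (\sum_(i <- r | P i) x i) f w = \sum_(i <- r | P i) free_act (x i) f w.
Proof. exact: (raddf_sum (mmap idfun (fun k => mon_op k f w))). Qed.

Lemma free_actU (c : F) (k : {fmonom klr_gen e n}) f w :
  free_act << c *g k >> f w = c * mon_op k f w.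
Proof. by rewrite /free_act mmapU. Qed.

Lemma free_actM x y f : free_act (x * y) f = free_act x (free_act y f).
Proof.
apply: funext => w; rewrite (malgME (x : {malg F[{fmonom klr_gen e n}]}) y).
rewrite free_act_sum [RHS]/free_act mmapE; apply: eq_bigr => k _.
rewrite free_act_sum /=.
have [a [w' h]] := mon_opE k w.
rewrite h /free_act mmapE !mulr_sumr; apply: eq_bigr => k' _.
rewrite mmapU /= -mulrA; congr (_ * _).
have -> : mon_op (mmul k k') f w = mon_op k (mon_op k' f) w.
  by rewrite /mon_op fmM foldr_cat.
by rewrite h !mulrA [a * _]mulrC.
Qed.

Lemma free_actC (c : F) f w :
  free_act (c%:MP : {malg F[{fmonom klr_gen e n}]}) f w = c * f w.
Proof. by rewrite free_actU /mon_op fm1. Qed.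

Lemma free_act1 f : free_act 1 f = f.
Proof.
apply: funext => w; rewrite -[RHS]mul1r -(free_actC 1 f).
by rewrite mpolyC1E.
Qed.

Lemma free_act_gen g f : free_act (free_gen F g) f = gen_op g f.
Proof.
apply: funext => w; rewrite /free_gen free_actU mul1r /mon_op.
by rewrite (fmU g).
Qed.

Lemma free_act_e i f : free_act (free_e F i) f = e_op i f.
Proof. exact: free_act_gen. Qed.

Lemma free_act_y r f : (0 < r <= n)%N -> free_act (free_y F e n r) f = y_op r f.
Proof. by move=> hr; rewrite /free_y insubT free_act_gen. Qed.

Lemma free_act_psi r f : (0 < r < n)%N ->
  free_act (free_psi F e n r) f = psi_op r f.
Proof. by move=> hr; rewrite /free_psi insubT free_act_gen. Qed.

Lemma free_act_linear x (c : F) f g w :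
  free_act x (fun w => c * f w + g w) w = c * free_act x f w + free_act x g w.
Proof.
rewrite /free_act !mmapE mulr_sumr -big_split; apply: eq_bigr => k _ /=.
have [a [w' h]] := mon_opE k w.
by rewrite !h; ring.
Qed.

Lemma free_act_action : is_action free_act.
Proof.
split; [exact: free_actD|exact: free_actM|exact: free_act1|].
exact: free_act_linear.
Qed.

Lemma free_act_rel x x' f : klr_rel x x' -> free_act x f = free_act x' f.
Proof.
case=> {x x'}.
- move=> i j; exact: (act_ee free_act_action free_act_e).
- exact: (act_e_sum free_act_action free_act_e).
- move=> r i; exact: (act_ye free_act_action free_act_e free_act_y).
- move=> r i; exact: (act_psie free_act_action free_act_e free_act_psi).
- move=> r s; exact: (act_yy free_act_action free_act_y).
- move=> r s; exact: (act_psiy free_act_action free_act_y free_act_psi).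
- move=> r s; exact: (act_psipsi free_act_action free_act_psi).
- move=> r i; exact: (act_psiyS free_act_action free_act_e free_act_y free_act_psi).
- move=> r i; exact: (act_ySpsi free_act_action free_act_e free_act_y free_act_psi).
- move=> r i; exact: (act_psi2 free_act_action free_act_e free_act_y free_act_psi).
- move=> r i; exact: (act_braid free_act_action free_act_e free_act_psi).
Qed.

Definition klr_act : klr F e n -> wfun -> wfun :=
  quot_act free_act (rel := @klr_rel F e n).

Lemma klr_actE x f : klr_act (ring_proj (@klr_rel F e n) x) f = free_act x f.
Proof. exact: (quot_actE free_act_action free_act_rel). Qed.

Lemma klr_act_action : is_action klr_act.
Proof. exact: (quot_act_action free_act_action free_act_rel). Qed.

Hypothesis n_gt0 : (0 < n)%N.

Lemma klr_act_cyc x x' f : cyc_rel kappa x x' -> klr_act x f = klr_act x' f.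
Proof.
case=> i; rewrite klr_actE.
rewrite (act_cyc free_act_action free_act_e free_act_y n_gt0).
by apply: funext => w; rewrite (act0 klr_act_action).
Qed.

Definition cklr_act : cklr F n kappa -> wfun -> wfun :=
  quot_act klr_act (rel := @cyc_rel F e n kappa).

Lemma cklr_act_action : is_action cklr_act.
Proof. exact: (quot_act_action klr_act_action klr_act_cyc). Qed.

Lemma cklr_actE x f : cklr_act (@free_to_cklr F e n kappa x) f = free_act x f.
Proof.
rewrite -klr_actE.
exact: (quot_actE klr_act_action klr_act_cyc).
Qed.

End WordAction.

(** * Standard vectors span the Specht module *)

Definition initial_word (m : nat) : word := fun k => (k <= m)%N.

Lemma legs_initial m k : legs (initial_word m) k = minn k m.
Proof.
elim: k => [|k ih]; first by rewrite /legs big_geq // min0n.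
by rewrite legsS ih /initial_word; lia.
Qed.

Section Spanning.
Variables (e n m : nat) (kappa : 'Z_e * 'Z_e).
Hypotheses (n_kappa : n%:R = kappa.2 - kappa.1 + 1) (mn : (m <= n)%N).

Variables (A : pzRingType) (E : n.-tuple 'Z_e -> A) (y psi : nat -> A).
Hypothesis ee : forall i j, E i * E j = if i == j then E i else 0.
Hypothesis psi_e : forall r i, (0 < r < n)%N ->
  psi r * E i = E (swap_res r i) * psi r.
Hypothesis psi_y : forall r s, (0 < r < n)%N -> (0 < s <= n)%N ->
  s != r -> s != r.+1 -> psi r * y s = y s * psi r.
Hypothesis psi_psi : forall r s, (0 < r < n)%N -> (0 < s < n)%N ->
  ((r.+1 < s) || (s.+1 < r))%N -> psi r * psi s = psi s * psi r.
Hypothesis psi_yS : forall r i, (0 < r < n)%N ->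
  psi r * y r.+1 * E i = (y r * psi r + (res i r == res i r.+1)%:R) * E i.
Hypothesis yS_psi : forall r i, (0 < r < n)%N ->
  y r.+1 * psi r * E i = (psi r * y r + (res i r == res i r.+1)%:R) * E i.
Hypothesis psi2 : forall r i, (0 < r < n)%N ->
  psi r * psi r * E i =
  if res i r == res i r.+1 then 0
  else if res i r.+1 == res i r + 1 then (y r.+1 - y r) * E i
  else if res i r.+1 == res i r - 1 then (y r - y r.+1) * E i
  else E i.
Hypothesis braid : forall r i, (0 < r)%N -> (r.+1 < n)%N ->
  psi r * psi r.+1 * psi r * E i =
  (let b := psi r.+1 * psi r * psi r.+1 in
   if (res i r.+2 == res i r) && (res i r.+1 == res i r + 1)
   then (b + 1) * E i
   else if (res i r.+2 == res i r) && (res i r.+1 == res i r - 1)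
   then (b - 1) * E i
   else b * E i).

Variables (K : pzRingType) (cst : K -> A).
Hypothesis cst_comm_e : forall c i, cst c * E i = E i * cst c.
Hypothesis cst_comm_y : forall c r, cst c * y r = y r * cst c.
Hypothesis cst_comm_psi : forall c r, cst c * psi r = psi r * cst c.

Variables (V : lmodType A) (z : V).
Hypothesis z_e : E (hook_res n kappa m) *: z = z.
Hypothesis z_y : forall r, (0 < r <= n)%N -> y r *: z = 0.
Hypothesis z_psi : forall r, (0 < r < n)%N -> r != m -> psi r *: z = 0.

(* The standard basis as a relation between words and vectors; that
   [v(a_1, ..., a_m)] does not depend on the order of the transpositions is
   [std_inj]. *)
Inductive std : nat -> word -> V -> Prop :=
| std0 : std 0 (initial_word m) z
| stdS j r w x of (0 < r < n)%N & w r & ~~ w r.+1 & std j w x :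
    std j.+1 (swap r r.+1 w) (psi r *: x).

Let swap_l r w : swap r r.+1 w r = w r.+1. Proof. by rewrite /swap eqxx. Qed.

Let swap_r r w : swap r r.+1 w r.+1 = w r.
Proof. by rewrite /swap gtn_eqF // eqxx. Qed.

(** Shuffles are fully commutative. If the outermost factor is [psi_r] with [r] different from [s],
    the letters rule out that [r] and [s] are neighbours, so [psi_s] can be brought to the front by
    far commutations alone. *)
Lemma std_exchange j w x s : std j w x -> (0 < s < n)%N -> ~~ w s -> w s.+1 ->
  exists j' x', [/\ j = j'.+1, x = psi s *: x' & std j' (swap s s.+1 w) x'].
Proof.
move=> h hs; elim: h => {j w x} [|j r w x hr w1 w2 hx ih].
  by rewrite /initial_word; lia.
have [->|sr] := eqVneq s r; first by move=> _ _; exists j, x; rewrite swapK.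
have [rs1|rs1] := eqVneq r s.+1; first by rewrite rs1 swap_l -rs1 (negbTE w2).
have [sr1|sr1] := eqVneq s r.+1; first by rewrite sr1 swap_r w1.
rewrite !swapE; [|lia..] => ws ws1.
have [j' [x' [-> -> h]]] := ih ws ws1.
exists j'.+1, (psi r *: x'); split=> //.
  by rewrite !scalerA psi_psi //; lia.
rewrite swap_comm; [|lia..].
by apply: stdS h; rewrite // swapE //; lia.
Qed.

Lemma std_inj j j' w x x' : std j w x -> std j' w x' -> x = x'.
Proof.
move=> h; elim: h j' x' => {j w x} [|j r w x hr w1 w2 hx ih] j' x' h'.
  move eq_w: (initial_word m) h' => w0 h'.
  case: h' eq_w => // j1 r w x1 _ w1 w2 _ /(congr1 (fun w0 : word => ~~ w0 r && w0 r.+1)).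
  by rewrite swap_l swap_r w1 w2 /initial_word; lia.
have [||j1 [x1 [_ ->]]] := std_exchange h' hr; rewrite ?swap_l ?swap_r //.
by rewrite swapK => /ih ->.
Qed.

Lemma std_outside j w x : std j w x -> w 0%N /\ forall k, (n < k)%N -> w k = false.
Proof.
elim=> {j w x} [|j r w x hr w1 w2 hx [w0 wn]].
  by split=> // k; rewrite /initial_word; lia.
split=> [|k nk]; first by rewrite swapE //; lia.
by rewrite swapE ?wn //; lia.
Qed.

Lemma word_res_initial : word_res n kappa (initial_word m) = hook_res n kappa m.
Proof.
apply: eq_mktuple => k; rewrite /wres legs_initial /initial_word.
by case: ltnP => km //; rewrite natrB // addrA.
Qed.

Let word_res_swap r w : (0 < r < n)%N -> w r -> ~~ w r.+1 ->
  word_res n kappa (swap r r.+1 w) = swap_res r (word_res n kappa w).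
Proof.
case: r => // q hq w1 w2; apply: res_ext => -[//|k] /= kn.
rewrite res_word // wres_swap2 ?w1 // /transp res_swap // !eqSS.
have [kq|kq] := eqVneq k q; first by rewrite res_word.
by have [kq1|kq1] := eqVneq k q.+1; rewrite res_word //; lia.
Qed.

Lemma std_e j w x : std j w x -> E (word_res n kappa w) *: x = x.
Proof.
elim=> {j w x} [|j r w x hr w1 w2 hx ih]; first by rewrite word_res_initial.
by rewrite word_res_swap // scalerA -psi_e // -scalerA ih.
Qed.

Let std_split (a a' : A) j w x : std j w x ->
  a * E (word_res n kappa w) = a' * E (word_res n kappa w) -> a *: x = a' *: x.
Proof. by move=> hx h; rewrite -(std_e hx) !scalerA h. Qed.

(** The filtration by length, with standard vectors of length below [k]. Scalars appear through
    [cst] because [V] is only given as a module over [A]. *)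
Inductive span (k : nat) : V -> Prop :=
| span0 : span k 0
| spanD x x' of span k x & span k x' : span k (x + x')
| spanN x of span k x : span k (- x)
| spanZ c x of span k x : span k (cst c *: x)
| span_std j w x of (j < k)%N & std j w x : span k x.

Lemma span_mono k k' x : (k <= k')%N -> span k x -> span k' x.
Proof.
move=> kk'; elim=> {x} [|x x' _ h _ h'|x _ h|c x _ h|j w x jk h].
- exact: span0.
- exact: spanD.
- exact: spanN.
- exact: spanZ.
- by apply: span_std h; apply: leq_trans kk'.
Qed.

(** A [psi] that does not produce a longer standard vector keeps the length at most [j], and every
    [y] strictly lowers it. The two claims need each other: squares of [psi] produce [y]'s, and a
    [y] must be moved past [psi]'s. *)
Definition reduces k := forall j w x, (j < k)%N -> std j w x ->
  (forall s, (0 < s < n)%N -> ~~ (w s && ~~ w s.+1) -> span j.+1 (psi s *: x)) /\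
  (forall s, (0 < s <= n)%N -> span j (y s *: x)).

Let span_psi k x s : reduces k -> (0 < s < n)%N -> span k x ->
  span k.+1 (psi s *: x).
Proof.
move=> hk hs; elim=> {x} [|x x' _ h _ h'|x _ h|c x _ h|j w x jk h].
- by rewrite scaler0; apply: span0.
- by rewrite scalerDr; apply: spanD.
- by rewrite scalerN; apply: spanN.
- by rewrite scalerA -cst_comm_psi -scalerA; apply: spanZ.
have [/andP[w1 w2]|ws] := boolP (w s && ~~ w s.+1).
  by apply: span_std (stdS hs w1 w2 h).
by apply: span_mono (proj1 (hk _ _ _ jk h) s hs ws); apply: ltnW.
Qed.

Let span_delta k j w x (b : bool) : (j < k)%N -> std j w x ->
  span k ((b%:R : A) *: x).
Proof.
move=> jk h; case: b; rewrite ?scale1r ?scale0r; last exact: span0.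
exact: span_std h.
Qed.

Lemma reducesP k : reduces k.
Proof.
elim: k => [//|k ih] j w x; rewrite ltnS leq_eqVlt => /orP[/eqP->{j}|jk]; last first.
  exact: ih.
move=> h; case: k w x / h ih => [ih|k r w x hr w1 w2 hx ih].
  split=> s hs; last by rewrite z_y //; apply: span0.
  move=> ws; rewrite z_psi ?scaler0 //; first exact: span0.
  by apply: contraNneq ws => ->; rewrite /initial_word; lia.
have psi_up s v : (0 < s < n)%N -> span k.+1 v -> span k.+2 (psi s *: v).
  exact: span_psi.
have ihk : reduces k by move=> j' w' x' jk; apply: ih; apply: ltnW.
have [ihx ihy] := ih _ _ _ (ltnSn k) hx.
have psi_up' s v : (0 < s < n)%N -> span k v -> span k.+1 (psi s *: v).
  exact: span_psi.
split=> s hs.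
- move=> ws.
  have hW : std k.+1 (swap r r.+1 w) (psi r *: x) by apply: stdS hx.
  (* Arm before leg at [s]: the vector is [psi_s x1] with [x1] standard and shorter, and the square
     of [psi_s] leaves [x1] or terms [y x1]. *)
  have [/andP[ws1 ws2]|ws'] := boolP (~~ (swap r r.+1 w) s && (swap r r.+1 w) s.+1).
    have [j [x1 [[<-] -> hx1]]] := std_exchange hW hs ws1 ws2.
    have [_ ihy1] := ih _ _ _ (ltnSn k) hx1.
    have y1 t : (0 < t <= n)%N -> span k.+2 (y t *: x1).
      by move=> ht; apply: span_mono (ihy1 _ ht); lia.
    have := psi2 (word_res n kappa (swap s s.+1 (swap r r.+1 w))) hs.
    case: ifP => _; [|case: ifP => _; [|case: ifP => _]] => h; rewrite scalerA.
    + rewrite (std_split (a' := 0) hx1) ?mul0r // scale0r; exact: span0.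
    + rewrite (std_split hx1 h) scalerBl.
      by apply: spanD; [|apply: spanN]; apply: y1; lia.
    + rewrite (std_split hx1 h) scalerBl.
      by apply: spanD; [|apply: spanN]; apply: y1; lia.
    + rewrite (std_split (a' := 1) hx1) ?mul1r // scale1r.
      by apply: span_std hx1; lia.
  have {ws ws'} wss : (swap r r.+1 w) s = (swap r r.+1 w) s.+1.
    by case: ((swap r r.+1 w) s) ((swap r r.+1 w) s.+1) ws ws' => [] [].
  have sr : s != r.
    by apply/eqP => sr; move: wss; rewrite sr swap_l swap_r w1 (negbTE w2).
  have [sr1|sr1] := eqVneq r s.+1.
    have ws0 : (swap r r.+1 w) s = w s by rewrite swapE //; lia.
    have ws1 : (swap r r.+1 w) s.+1 = w s.+2 by rewrite -sr1 swap_l sr1.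
    have wsN : ~~ w s by rewrite -ws0 wss ws1 -sr1.
    rewrite sr1 in w1 w2 hr *.
    have [j [x1 [ek -> hx1]]] := std_exchange hx hs wsN w1.
    pose i := word_res n kappa (swap s s.+1 w).
    (* The word of [x1] reads leg, arm, arm from [s] on, so [psi_{s+1}] does not lengthen [x1], and
       the reversed triple product gains at most 2 in length, not 3. *)
    have h := braid i (proj1 (andP hs)) (proj2 (andP hr)).
    have psi3 : span k.+2 ((psi s.+1 * psi s * psi s.+1) *: x1).
      rewrite -!scalerA; apply: psi_up => //; apply: psi_up' => //.
      apply: span_mono (proj1 (ih _ _ _ _ hx1) _ hr _); try lia.
      by rewrite swap_r (negbTE wsN).
    have spx1 : span k.+2 x1 by apply: span_std hx1; lia.
    rewrite !scalerA.
    move: h; rewrite /=; case: ifP => _; [|case: ifP => _] => h.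
    + by rewrite (std_split hx1 h) scalerDl scale1r; apply: spanD.
    + rewrite (std_split hx1 h) scalerBl scale1r.
      by apply: spanD => //; apply: spanN.
    + by rewrite (std_split hx1 h).
  have [rs1|rs1] := eqVneq s r.+1.
    have ws0 : (swap r r.+1 w) s = true by rewrite rs1 swap_r w1.
    have ws1 : w s.+1 = true.
      by rewrite -ws0 wss swapE //; lia.
    have wsN : ~~ w s by rewrite rs1.
    have [j [x1 [ek -> hx1]]] := std_exchange hx hs wsN ws1.
    pose i := word_res n kappa (swap s s.+1 w).
    rewrite rs1 in wsN hx1 hs i *.
    (* Mirror image: from [r] on, the word of [x1] reads leg, leg, arm, and [psi_r] does not
       lengthen [x1]. *)
    have h := braid i (proj1 (andP hr)) (proj2 (andP hs)).
    have psi3 : span k.+2 ((psi r * psi r.+1 * psi r) *: x1).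
      rewrite -!scalerA; apply: psi_up => //; apply: psi_up' => //.
      apply: span_mono (proj1 (ih _ _ _ _ hx1) _ hr _); try lia.
      by rewrite swap_l -rs1 ws1 andbF.
    have spx1 : span k.+2 x1 by apply: span_std hx1; lia.
    rewrite !scalerA.
    move: h; rewrite /=; case: ifP => _; [|case: ifP => _] => h.
    + have -> : (psi r.+1 * psi r * psi r.+1) *: x1 =
          (psi r * psi r.+1 * psi r) *: x1 - x1.
        by rewrite (std_split hx1 h) scalerDl scale1r addrK.
      by apply: spanD => //; apply: spanN.
    + have -> : (psi r.+1 * psi r * psi r.+1) *: x1 =
          (psi r * psi r.+1 * psi r) *: x1 + x1.
        by rewrite (std_split hx1 h) scalerBl scale1r subrK.
      exact: spanD.
    + by rewrite -(std_split hx1 h).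
  rewrite scalerA psi_psi; [|lia..]; rewrite -scalerA; apply: psi_up => //.
  apply: ihx => //; move: wss; rewrite !swapE; [|lia..].
  by move=> ->; rewrite andbN.
- have [->|sr] := eqVneq s r.
    have -> : y r *: (psi r *: x) = psi r *: (y r.+1 *: x) -
        (res (word_res n kappa w) r == res (word_res n kappa w) r.+1)%:R *: x.
      rewrite !scalerA -scalerBl; apply: (std_split hx).
      by rewrite mulrBl psi_yS // mulrDl addrK.
    apply: spanD; last by apply: spanN; apply: span_delta hx.
    by apply: psi_up' => //; apply: ihy; lia.
  have [->|sr1] := eqVneq s r.+1.
    have -> : y r.+1 *: (psi r *: x) = psi r *: (y r *: x) +
        (res (word_res n kappa w) r == res (word_res n kappa w) r.+1)%:R *: x.
      rewrite !scalerA -scalerDl; apply: (std_split hx).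
      by rewrite yS_psi.
    apply: spanD; last by apply: span_delta hx.
    by apply: psi_up' => //; apply: ihy; lia.
  by rewrite scalerA -psi_y // -scalerA; apply: psi_up' => //; apply: ihy.
Qed.

Definition spanned x := exists k, span k x.

Lemma spanned_psi s x : (0 < s < n)%N -> spanned x -> spanned (psi s *: x).
Proof. by move=> hs [k h]; exists k.+1; apply: span_psi h => //; apply: reducesP. Qed.

Lemma spanned_y s x : (0 < s <= n)%N -> spanned x -> spanned (y s *: x).
Proof.
move=> hs [k h]; exists k; elim: h => {x} [|x x' _ h _ h'|x _ h|c x _ h|j w x jk h].
- by rewrite scaler0; apply: span0.
- by rewrite scalerDr; apply: spanD.
- by rewrite scalerN; apply: spanN.
- by rewrite scalerA -cst_comm_y -scalerA; apply: spanZ.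
by apply: span_mono (proj2 (@reducesP k _ _ _ jk h) s hs); apply: ltnW.
Qed.

Lemma spanned_e i x : spanned x -> spanned (E i *: x).
Proof.
move=> [k h]; exists k; elim: h => {x} [|x x' _ h _ h'|x _ h|c x _ h|j w x jk h].
- by rewrite scaler0; apply: span0.
- by rewrite scalerDr; apply: spanD.
- by rewrite scalerN; apply: spanN.
- by rewrite scalerA -cst_comm_e -scalerA; apply: spanZ.
rewrite -(std_e h) scalerA ee; case: eqP => [->|_]; rewrite ?scale0r.
  by rewrite (std_e h); apply: span_std h.
exact: span0.
Qed.

Lemma spannedD x x' : spanned x -> spanned x' -> spanned (x + x').
Proof.
move=> [k h] [k' h']; exists (maxn k k').
by apply: spanD; [apply: span_mono h | apply: span_mono h']; rewrite leq_max leqnn ?orbT.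
Qed.

Lemma spannedZ c x : spanned x -> spanned (cst c *: x).
Proof. by move=> [k h]; exists k; apply: spanZ. Qed.

Lemma spanned_z : spanned z.
Proof. by exists 1%N; apply: span_std std0. Qed.

Hypotheses (cstD : forall c d, cst (c + d) = cst c + cst d)
  (cstM : forall c d, cst (c * d) = cst c * cst d) (cst1 : cst 1 = 1).

Let cst0 : cst 0 = 0.
Proof. by apply: (addrI (cst 0)); rewrite -cstD !addr0. Qed.

Variable rho : V -> word -> K.
Hypotheses (rhoD : forall x x' w, rho (x + x') w = rho x w + rho x' w)
  (rhoZ : forall c x w, rho (cst c *: x) w = c * rho x w)
  (rho_std : forall j w x, std j w x ->
     forall w', rho x w' = if `[< w' = w >] then 1 else 0).

Let rho0 w : rho 0 w = 0.
Proof. by rewrite -(scaler0 V (cst 0)) rhoZ mul0r. Qed.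

Let cstN c : cst (- c) = - cst c.
Proof. by apply/eqP; rewrite -addr_eq0 -cstD addNr cst0. Qed.

Let rhoN x w : rho (- x) w = - rho x w.
Proof. by apply/eqP; rewrite -addr_eq0 -rhoD addNr rho0. Qed.

Definition word_of (t : n.-tuple bool) : word :=
  fun k => if k is k'.+1 then nth false t k' else true.

Let word_ofP w : w 0%N -> (forall k, (n < k)%N -> w k = false) ->
  word_of [tuple w k.+1 | k < n] = w.
Proof.
move=> w0 wn; apply: funext => -[|k]; rewrite /word_of; first by rewrite w0.
have [kn|nk] := ltnP k n; last by rewrite nth_default ?wn ?size_tuple.
by rewrite -(tnth_nth false _ (Ordinal kn)) tnth_mktuple.
Qed.

Let word_of_inj : injective word_of.
Proof.
move=> t t' h; apply: eq_from_tnth => k; rewrite !(tnth_nth false).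
by have := congr1 (fun w : word => w k.+1) h.
Qed.

(** A word determines its standard vector, so [u] can be chosen, with value 0 where there is none,
    and [rho] reads off the coefficients. Words of standard vectors are constant outside 1, ...,
    [n], hence a finite sum over bit tuples. *)
Lemma spanned_coord : exists u : n.-tuple bool -> V, forall x, spanned x ->
  x = \sum_t cst (rho x (word_of t)) *: u t.
Proof.
have [u uP] : {u : n.-tuple bool -> V &
    forall t j x, std j (word_of t) x -> x = u t}.
  apply: (@choice _ _ (fun t v => forall j x, std j (word_of t) x -> x = v)) => t.
  have [[j [x hx]]|no] := pselect (exists j x, std j (word_of t) x).
    by exists x => j' x' h; apply: std_inj h hx.
  by exists 0 => j x h; case: no; exists j, x.
exists u => x [k]; elim=> {x} [|x x' _ h _ h'|x _ h|c x _ h|j w x _ h].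
- by rewrite big1 // => t _; rewrite rho0 cst0 scale0r.
- rewrite {1}h {1}h' -big_split; apply: eq_bigr => t _.
  by rewrite rhoD cstD scalerDl.
- by rewrite {1}h -sumrN; apply: eq_bigr => t _; rewrite rhoN cstN scaleNr.
- rewrite {1}h scaler_sumr; apply: eq_bigr => t _.
  by rewrite rhoZ cstM scalerA.
have [w0 wn] := std_outside h; pose t0 := [tuple w k.+1 | k < n].
have wt0 : word_of t0 = w by apply: word_ofP.
rewrite (bigD1 t0) //= big1 => [|t tt0].
  rewrite addr0 (rho_std h) asboolT ?wt0 // cst1 scale1r.
  by apply: (uP t0 j); rewrite wt0.
rewrite (rho_std h) asboolF ?cst0 ?scale0r // => wt.
by case/eqP: tt0; apply: word_of_inj; rewrite wt0.
Qed.

Lemma spanned_eq0 x : spanned x -> (forall w, rho x w = 0) -> x = 0.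
Proof.
move=> hx rx; have [u uE] := spanned_coord.
by rewrite (uE _ hx) big1 // => t _; rewrite rx cst0 scale0r.
Qed.

End Spanning.

(** * Moving legs to the left *)

(** [PsiMoveUp] unites the rules in which [f] is read at a word whose leg at [y] has moved left to
    [x] in the present word; the sign is left open, since only vanishing or support matters where
    this is used. *)
Variant psi_move_spec (C : nat -> bool) q (g : nat -> bool) : move -> Prop :=
| PsiMoveNone x y : psi_move_spec C q g (None, x, y)
| PsiMoveDown of ~~ g q.+1 & g q.+2 :
    psi_move_spec C q g (Some true, q.+1, q.+2)
| PsiMoveUp b x y of g x & ~~ g y &
    [\/ [/\ x = q.+1, y = q.+2, ~~ C q, ~~ C q.+1 & ~~ C q.+2],
        [/\ x = q.+1, y = q.+3, ~~ C q.+1 & C q.+2]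
      | [/\ x = q, y = q.+2, ~~ C q.+1 & C q] ] :
    psi_move_spec C q g (Some b, x, y).

Lemma psi_moveP C q g : psi_move_spec C q g (psi_move C q g).
Proof.
rewrite /psi_move; case: ifP => [/andP[h1 h2]|_]; first exact: PsiMoveDown.
have [c1|c1] := boolP (C q.+1); first exact: PsiMoveNone.
have [c2|c2] := boolP (C q.+2).
  case: ifP => [/andP[h1 h3]|_]; last exact: PsiMoveNone.
  by apply: PsiMoveUp => //; constructor 2.
have [c0|c0] := boolP (C q).
  case: ifP => [/andP[h1 h3]|_]; last exact: PsiMoveNone.
  by apply: PsiMoveUp => //; constructor 3.
case: ifP => [/andP[h1 h3]|_]; last exact: PsiMoveNone.
by apply: PsiMoveUp => //; constructor 1.
Qed.

Variant y_move_spec (C : nat -> bool) q (g : nat -> bool) : move -> Prop :=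
| YMoveNone x y : y_move_spec C q g (None, x, y)
| YMoveUp b x of C x & g x & ~~ g x.+1 & ((x == q) || (x == q.+1)) :
    y_move_spec C q g (Some b, x, x.+1).

Lemma y_moveP C q g : y_move_spec C q g (y_move C q g).
Proof.
rewrite /y_move; case: ifP => [/and3P[c h1 h2]|_].
  by apply: YMoveUp; rewrite // eqxx orbT.
case: ifP => [/and3P[c h1 h2]|_]; last exact: YMoveNone.
by apply: YMoveUp; rewrite // eqxx.
Qed.

Lemma swap_at_l x y w : swap x y w x = w y.
Proof. by rewrite /swap eqxx. Qed.

Lemma swap_at_r x y w : swap x y w y = w x.
Proof. by rewrite /swap eqxx; case: eqP => [->|]. Qed.

Lemma swapC x y w : swap x y w = swap y x w.
Proof.
by apply: funext => k; rewrite /swap; do 2 case: eqP => // ->.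
Qed.

(** The three transpositions compose to the one of [a] and [c], which [w] does not see. *)
Lemma swap_cycle a b c w : a != b -> b != c -> a != c -> w a = w c ->
  swap b c (swap a c (swap a b w)) = w.
Proof.
move=> ab bc ac wac; have [ba cb ca] : [/\ b != a, c != b & c != a].
  by rewrite ![c == _]eq_sym [b == _]eq_sym.
apply: funext => k; have [->|kb] := eqVneq k b.
  by rewrite swap_at_l swap_at_r swap_at_l.
have [->|kc] := eqVneq k c; first by rewrite swap_at_r swapE // swap_at_r.
rewrite swapE //; have [->|ka] := eqVneq k a; first by rewrite swap_at_l swapE.
by rewrite !swapE.
Qed.

(** * Basis functions and the initial word *)

Section Delta.
Variables (F : fieldType) (e n : nat).

Local Notation wfun := (word -> F).
Local Notation Psi := (@psi_op F e n).
Local Notation Y := (@y_op F e n).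

Definition delta w : wfun := fun w' => if `[< w' = w >] then 1 else 0.

Lemma deltaE w : delta w w = 1.
Proof. by rewrite /delta; case: asboolP. Qed.

Lemma delta_neq w w' : w' <> w -> delta w w' = 0.
Proof. by rewrite /delta; case: asboolP. Qed.

(** Every other rule reads its argument at a word with an arm at [r] or a leg at [r.+1], and [w] has
    neither, so a single term survives. *)
Lemma psi_op_delta r w : (0 < r)%N -> w r -> ~~ w r.+1 ->
  Psi r (delta w) = delta (swap r r.+1 w).
Proof.
case: r => // q _ w1 w2; apply: funext => w'; rewrite /psi_op /move_op /=.
have [->|ne] := pselect (w' = swap q.+1 q.+2 w).
  rewrite deltaE /psi_move swap_at_l swap_at_r (negbTE w2) w1 /=.
  by rewrite swapK deltaE.
rewrite [RHS]delta_neq //; case: psi_moveP => //= [_ _|b x y wx wy h].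
  by rewrite delta_neq // => E; apply: ne; rewrite -E swapK.
have ne' : swap x y w' <> w.
  move=> E; move: w1 w2 wx wy; rewrite -E.
  case: h => [[-> -> _ _ _]|[-> -> _ _]|[-> -> _ _]] w1 w2 wx wy.
  - by move: w1; rewrite swap_at_l (negbTE wy).
  - by move: w1; rewrite swap_at_l (negbTE wy).
  - by move: w2; rewrite swap_at_r wx.
by rewrite delta_neq //; case: b => //; rewrite oppr0.
Qed.

(** No arm precedes a leg in the initial word; hence the rules that move a leg to the left never
    read it, which kills it under [y] and most [psi]. *)
Lemma initial_word_mono M w' x y : (x < y)%N ->
  swap x y w' = initial_word M -> w' x -> w' y.
Proof.
move=> xy E wx; have := congr1 (fun u : word => u x) E.
have := congr1 (fun u : word => u y) E.
rewrite swap_at_l swap_at_r wx /initial_word => h1 ->; lia.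
Qed.

Lemma psi_op_initial M r : (0 < r)%N -> r != M ->
  Psi r (delta (initial_word M)) = fun=> 0.
Proof.
case: r => // q _ qM; apply: funext => w'; rewrite /psi_op /move_op /=.
case: psi_moveP => //= [w1 w2|b x y wx wy h].
  rewrite delta_neq // => E; have := congr1 (fun u : word => u q.+1) E.
  have := congr1 (fun u : word => u q.+2) E.
  by rewrite swap_at_l swap_at_r w2 (negbTE w1) /initial_word; lia.
have xy : (x < y)%N by case: h => [[-> ->]|[-> ->]|[-> ->]]; lia.
rewrite delta_neq; first by case: b; rewrite ?oppr0.
by move=> E; move: wy; rewrite (initial_word_mono xy E wx).
Qed.

Lemma y_op_initial M r : Y r (delta (initial_word M)) = fun=> 0.
Proof.
apply: funext => w'; rewrite /y_op /move_op.
case: y_moveP => //= b x _ wx wy _.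
rewrite delta_neq; first by case: b; rewrite ?oppr0.
by move=> E; move: wy; rewrite (initial_word_mono (ltnSn x) E wx).
Qed.

End Delta.

(** * Functions supported on words with a leg at position [n] *)

Section WordModule.
Variables (F : fieldType) (e n m : nat) (kappa : 'Z_e * 'Z_e).
Hypotheses (e_gt2 : (2 < e)%N) (n_kappa : n%:R = kappa.2 - kappa.1 + 1)
  (n_neq0 : n%:R != 0 :> 'Z_e) (mn : (m < n)%N).

Local Notation wfun := (word -> F).
Local Notation wR := (word_res n kappa).
Local Notation C := (@critical e n).
Local Notation Psi := (@psi_op F e n).
Local Notation Y := (@y_op F e n).
Local Notation Idem := (@e_op F e n kappa).
Implicit Types (f : wfun).

Let critical_gt0 k : C k -> (0 < k)%N.
Proof.
case: k => // c0; move: n_neq0.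
by rewrite eq_sym -/(critical e n 0) c0.
Qed.

Let critical_n : C n. Proof. by rewrite /critical. Qed.

Let C_sparse k : C k -> ~~ C k.+1 && ~~ C k.+2.
Proof. exact: critical_sparse. Qed.

(* The words spanning the image of [hook_hom]. *)
Definition good w : Prop :=
  [/\ w 0%N, w n, forall k, (n < k)%N -> w k = false & legs w n = m.+1].

Definition good_supp f := forall w, f w != 0 -> good w.

Lemma good_swap x y w : (0 < x)%N -> (x < y < n)%N -> w x != w y ->
  good (swap x y w) -> good w.
Proof.
move=> x0 xyn wxy [g0 gn gk gl]; have ne k : (k == 0)%N || (n <= k)%N -> swap x y w k = w k.
  by move=> hk; rewrite swapE //; lia.
split.
- by rewrite -ne.
- by rewrite -ne ?leqnn ?orbT.
- by move=> k nk; rewrite -ne ?gk //; lia.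
case: x x0 xyn wxy gl {ne g0 gn gk} => // x _; case: y => [|y xyn wxy gl]; first by rewrite ltn0.
have h : (x < n <= y)%N = false by lia.
case wx: (w x.+1) wxy => wxy.
  by rewrite (@legs_swap x y) ?gl ?h ?addn0 //; first lia; case: (w y.+1) wxy.
have := @legs_swap x y (swap x.+1 y.+1 w) n.
rewrite swapK swap_at_l swap_at_r wx gl h addn0 => -> //; first lia.
by case: (w y.+1) wxy.
Qed.

(** The leg at [n] stays because [n] is critical: a leg can leave [y] to the left only if [y] is not
    critical. A rule with [y] beyond [n] would read [f] at a word with a leg beyond [n], outside the
    support. *)
Lemma good_psi r f : (0 < r < n)%N -> good_supp f -> good_supp (Psi r f).
Proof.
case: r => // q qn hf w; rewrite /psi_op /move_op /=.
case: psi_moveP => [x y||b x y wx wy h]; first by rewrite /= eqxx.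
  move=> w1 w2 /= /hf g; apply: good_swap (g) => //; last by rewrite w2 (negbTE w1).
  have : (q.+2 <= n)%N by lia.
  rewrite leq_eqVlt => /orP[/eqP e1|]; last lia.
  by case: g => _; rewrite -e1 swap_at_r (negbTE w1).
move=> h'; have {h'} /hf g : f (swap x y w) != 0.
  by move: h'; case: b => /=; rewrite ?oppr_eq0.
have yn : (y <= n)%N.
  by rewrite leqNgt; apply/negP => ny; case: g => _ _ /(_ _ ny); rewrite swap_at_r wx.
have x0 : (0 < x)%N by case: h => [[-> //]|[-> //]|[-> _ _ /critical_gt0]].
apply: good_swap (g) => //; last by rewrite wx (negbTE wy).
have ny : y <> n.
  move=> yn'; case: h => [[_ ey _ _]|[_ ey _ /C_sparse]|[_ ey _ /C_sparse]].
  - by rewrite -ey yn' critical_n.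
  - by rewrite -ey yn' critical_n.
  - by rewrite -ey yn' critical_n andbF.
by case: h => [[ex ey _ _ _]|[ex ey _ _]|[ex ey _ _]]; lia.
Qed.

Lemma good_y r f : good_supp f -> good_supp (Y r f).
Proof.
move=> hf w; rewrite /y_op /move_op /=.
case: y_moveP => [x y|b x cx wx wy _]; first by rewrite /= eqxx.
move=> h'; have {h'} /hf g : f (swap x x.+1 w) != 0.
  by move: h'; case: b => /=; rewrite ?oppr_eq0.
have yn : (x.+1 <= n)%N.
  rewrite leqNgt; apply/negP => ny; case: g => _ _ /(_ _ ny).
  by rewrite swap_at_r wx.
apply: good_swap (g) => //; first exact: critical_gt0.
  rewrite ltnSn ltn_neqAle yn andbT; apply/eqP => xn.
  by have := C_sparse cx; rewrite xn critical_n.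
by rewrite wx (negbTE wy).
Qed.

Lemma good_e i f : good_supp f -> good_supp (Idem i f).
Proof. by move=> hf w; rewrite /e_op; case: ifP => _; [apply: hf | rewrite eqxx]. Qed.

Let psi_op_down q f w : ~~ w q.+1 -> w q.+2 ->
  Psi q.+1 f w = f (swap q.+1 q.+2 w).
Proof. by move=> w1 w2; rewrite /psi_op /move_op /psi_move /= w1 w2. Qed.

Inductive reach (f : wfun) : wfun -> Prop :=
| reach0 : reach f f
| reach_psi r g of (0 < r < n)%N & reach f g : reach f (Psi r g)
| reach_y r g of (0 < r <= n)%N & reach f g : reach f (Y r g)
| reach_e i g of reach f g : reach f (Idem i g)
| reach_scale c g of reach f g : reach f (fun w => c * g w).

Lemma reach_trans f g h : reach f g -> reach g h -> reach f h.
Proof.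
move=> fg; elim=> {h} [|r h hr _ ih|r h hr _ ih|i h _ ih|c h _ ih] //.
- exact: reach_psi.
- exact: reach_y.
- exact: reach_e.
- exact: reach_scale.
Qed.

Lemma reach_good f g : reach f g -> good_supp f -> good_supp g.
Proof.
elim=> {g} [|r g hr _ ih|r g hr _ ih|i g _ ih|c g _ ih] // /ih hf.
- exact: good_psi.
- exact: good_y.
- exact: good_e.
- move=> w; rewrite mulf_eq0 negb_or => /andP[_]; exact: hf.
Qed.

Definition target_word : word := fun k => (k <= m)%N || (k == n).

Let legs_le w k : (legs w k <= k)%N.
Proof.
elim: k => [|k ih]; first by rewrite /legs big_geq.
by rewrite legsS; case: (w k.+1); lia.
Qed.

Let legs_mono w k k' : (k <= k')%N -> (legs w k <= legs w k')%N.
Proof.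
elim: k' => [|k' ih]; first by rewrite leqn0 => /eqP->.
rewrite leq_eqVlt => /orP[/eqP->//|]; rewrite ltnS => /ih h.
by rewrite legsS; lia.
Qed.

(** One of the [m.+1] legs sits at [n]; if no arm directly precedes a leg before [n], the other [m]
    legs fill an initial segment. *)
Lemma good_sorted w : good w ->
  (forall k, (0 < k)%N -> (k.+1 < n)%N -> w k.+1 -> w k) -> w = target_word.
Proof.
move=> [w0 wn wk wl] sorted.
have wN : legs w n.-1 = m.
  have := legsS w n.-1; rewrite prednK ?(leq_ltn_trans _ mn) // wl wn; lia.
have up k : (k.+1 < n)%N -> w k.+1 -> legs w k.+1 = k.+1.
  elim: k => [|k ih] kn h; rewrite legsS h.
    by rewrite /legs big_geq.
  by rewrite ih ?addn1 //; [lia | apply: sorted].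
have down k d : (k.+1 + d < n)%N -> ~~ w k.+1 ->
    ~~ w (k.+1 + d)%N /\ legs w (k.+1 + d) = legs w k.
  elim: d => [|d ih] kn h; first by rewrite addn0 legsS (negbTE h) addn0.
  have [|h1 h2] := ih _ h; first lia.
  have h3 : ~~ w (k.+1 + d).+1.
    by apply: contraNN h1 => h1; apply: sorted => //; lia.
  by rewrite addnS legsS (negbTE h3) addn0.
apply: funext => k; rewrite /target_word.
case: k => [|k]; first by rewrite w0.
have [->|kn] := eqVneq k.+1 n; first by rewrite wn orbT.
rewrite orbF; have [nk|kn'] := leqP n k.+1.
  by rewrite wk; lia.
have [h|h] := boolP (w k.+1).
  have := up _ kn' h; have := @legs_mono w k.+1 n.-1; lia.
have [||_] := down k (n.-1 - k.+1)%N; rewrite ?subnKC; try lia.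
by rewrite wN => wk'; have := legs_le w k; lia.
Qed.

(** Termination measure: it grows whenever a leg moves left, and it is bounded. *)
Definition height w : nat := (\sum_(k < n.+1) legs w k)%N.

Let height_swap x y w : (0 < x)%N -> (x < y <= n)%N -> ~~ w x -> w y ->
  (height w < height (swap x y w))%N.
Proof.
case: x => // x _; case: y => [|y] xy wx wy; first lia.
have h k : legs (swap x.+1 y.+1 w) k = (legs w k + (x < k <= y))%N.
  rewrite (@legs_swap x y (swap x.+1 y.+1 w)) ?swapK ?swap_at_l ?swap_at_r //; lia.
rewrite /height; under [X in (_ < X)%N]eq_bigr => k _ do rewrite h.
rewrite big_split /= -[X in (X < _)%N]addn0 ltn_add2l.
have xn : (x.+1 < n.+1)%N by lia.
rewrite (bigD1 (Ordinal xn)) //=; lia.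
Qed.

(** Take an arm at [k] followed by a leg at [k.+1 < n]. Away from critical positions [psi_k]
    exchanges them, and at a critical [k] the operator [y_{k+1}] does. Next to a critical position
    [psi_k] carries a leg two places to the left if the third letter permits, and otherwise a second
    [psi] applied beforehand turns this into a net exchange of neighbours. The new value is [f w] up
    to sign. *)
Lemma climb f w : good_supp f -> f w != 0 -> w <> target_word ->
  exists g w', [/\ reach f g, g w' != 0 & (height w < height w')%N].
Proof.
move=> hf fw nw; have gw := hf w fw.
have [k [k0 kn wk wk1]] :
    exists k, [/\ (0 < k)%N, (k.+1 < n)%N, ~~ w k & w k.+1].
  apply: contrapT => no; apply: nw; apply: good_sorted => // k k0 kn wk1.
  by apply: contrapT => /negP wk; apply: no; exists k.
case: k k0 kn wk wk1 => // q _ qn w1 w2.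
have hq : (0 < q.+1 < n)%N by lia.
have [c1|c1] := boolP (C q.+1).
  have /andP[c2 _] := C_sparse c1.
  exists (Y q.+2 f), (swap q.+1 q.+2 w); split; last by apply: height_swap => //; clear -qn; lia.
    by apply: reach_y; [lia | apply: reach0].
  rewrite /y_op /move_op /y_move /= (negbTE c2) c1 swap_at_l swap_at_r w2 w1 /=.
  by rewrite swapK.
have [c2|c2] := boolP (C q.+2).
  have [w3|w3] := boolP (w q.+3).
    have q3 : (q.+3 <= n)%N.
      rewrite leqNgt; apply/negP => nq; case: gw => _ _ /(_ _ nq) wq _.
      by rewrite wq in w3.
    exists (Psi q.+1 f), (swap q.+1 q.+3 w).
    split; [by apply: reach_psi; [|apply: reach0] | |].
      2: by apply: height_swap => //; clear -q3; lia.
    rewrite /psi_op /move_op /psi_move /= swap_at_l swap_at_r w3 (negbTE w1) /=.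
    rewrite (negbTE c1) c2 swapE; [|by clear; lia..]; rewrite w2 /=.
    by rewrite swapK.
  have hq2 : (0 < q.+2 < n)%N by [].
  (* On positions [q.+1] to [q.+3]: at leg, arm, arm the outer operator reads arm, arm, leg, where
     the inner one reads arm, leg, arm, which is [w]. *)
  exists (Psi q.+1 (Psi q.+2 f)), (swap q.+1 q.+2 w).
  split; last by apply: height_swap => //; clear -qn; lia.
    by do 2 (apply: reach_psi => //); apply: reach0.
  rewrite {1}/psi_op /move_op /psi_move /= swap_at_l swap_at_r w2 (negbTE w1) /=.
  rewrite (negbTE c1) c2 swapE; [|by clear; lia..]; rewrite w3 /= oppr_eq0.
  have u1 : swap q.+1 q.+2 w q.+3 = w q.+3 by rewrite swapE //; clear; lia.
  rewrite psi_op_down.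
  - by rewrite swap_cycle ?(negbTE w1) ?(negbTE w3) //; clear; lia.
  - by rewrite swapE ?swap_at_r; [|by clear; lia..].
  - by rewrite swap_at_r swap_at_l.
have [c0|c0] := boolP (C q).
  have q0 := critical_gt0 c0.
  have [w0|w0] := boolP (w q).
    have hq2 : (0 < q < n)%N by rewrite q0; clear -qn; lia.
    (* On positions [q] to [q.+2]: leg, leg, arm leads to arm, leg, leg and then to leg, arm, leg,
       which is [w]. *)
    exists (Psi q.+1 (Psi q f)), (swap q.+1 q.+2 w).
    split; last by apply: height_swap => //; clear -qn; lia.
      by do 2 (apply: reach_psi => //); apply: reach0.
    rewrite {1}/psi_op /move_op /psi_move /= swap_at_l swap_at_r w2 (negbTE w1) /=.
    rewrite (negbTE c1) (negbTE c2) c0 swapE; [|by clear; lia..]; rewrite w0 /=.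
    case: q q0 {c0 c1 c2 hq} qn w0 w1 w2 hq2 => // p _ qn w0 w1 w2 hq2.
    rewrite psi_op_down.
    - rewrite (swapC p.+2) (swapC p.+1 p.+3) (swapC p.+1 p.+2).
      by rewrite swap_cycle ?w2 ?w0 //; clear; lia.
    - by rewrite swap_at_l swap_at_r.
    - by rewrite swapE ?swap_at_l; [|by clear; lia..].
  exists (Psi q.+1 f), (swap q q.+2 w).
  split; [by apply: reach_psi; [|apply: reach0] | |by apply: height_swap => //; clear -qn; lia].
  rewrite /psi_op /move_op /psi_move /= swap_at_l swap_at_r w2 (negbTE w0) /=.
  rewrite (negbTE c1) (negbTE c2) c0 swapE; [|by clear; lia..]; rewrite (negbTE w1) /= oppr_eq0.
  by rewrite swapK.
exists (Psi q.+1 f), (swap q.+1 q.+2 w).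
split; [by apply: reach_psi; [|apply: reach0] | |by apply: height_swap => //; clear -qn; lia].
rewrite /psi_op /move_op /psi_move /= swap_at_l swap_at_r w2 (negbTE w1) /=.
rewrite (negbTE c1) (negbTE c2) (negbTE c0) /=.
by rewrite swapK.
Qed.

Let height_le w : (height w <= n.+1 * n)%N.
Proof.
rewrite -[n.+1]card_ord -sum_nat_const; apply: leq_sum => k _.
by apply: leq_trans (legs_le _ _) _; rewrite -ltnS.
Qed.

Lemma reach_target f w : good_supp f -> f w != 0 ->
  exists g, reach f g /\ g target_word != 0.
Proof.
move: {2}(n.+1 * n - height w)%N (leqnn (n.+1 * n - height w)) => d.
elim: d f w => [|d ih] f w hd hf fw;
  (have [<-|nw] := pselect (w = target_word); first by exists f; split=> //; apply: reach0);
  have [g [w' [fg gw' hw]]] := climb hf fw nw; have := height_le w'; first lia.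
move=> hw'; have [|h [gh hh]] := ih g w' _ (reach_good fg hf) gw'; first by lia.
by exists h; split=> //; apply: reach_trans gh.
Qed.

(** At the first disagreement [q.+1] the residues still agree, so [q.+1] is critical. The target
    repeats its letter at [q.+2]: the last hypothesis excludes [q.+1 = m], and [q.+2 = n] would give
    two adjacent critical positions. So its next residue changes by -1 after a leg and by +1 after
    an arm, while a word with the other letter at [q.+1] changes by 0 or with the opposite sign. *)
Lemma target_unique w : good w -> wR w = wR target_word ->
  (C m -> w m && ~~ w m.+1) -> w = target_word.
Proof.
move=> [w0 wn wk wl] eqR Cm.
have res_eq q : (q < n)%N -> wres kappa w q = wres kappa target_word q.
  by move=> qn; rewrite -!(res_word kappa _ qn) eqR.
apply: funext => k; elim/ltn_ind: k => k ih.
case: k ih => [|q] ih; first by rewrite w0.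
have [nq|qn] := ltnP n q.+1; first by rewrite wk // /target_word; lia.
have [->|qn'] := eqVneq q.+1 n; first by rewrite wn /target_word eqxx orbT.
have legs_eq : legs w q = legs target_word q.
  by apply: eq_big_nat => j jq; rewrite ih //; lia.
have res0 := res_eq q qn; have {res_eq} res1 : wres kappa w q.+1 = wres kappa target_word q.+1.
  by apply: res_eq; lia.
apply: contrapT => neq.
have kap : kappa.2 = kappa.1 + q%:R.
  move: res0; rewrite /wres legs_eq.
  case: (w q.+1) (target_word q.+1) neq => [] [] // _.
    by move/addIr.
  by move/esym/addIr.
have cq : C q.+1 by rewrite /critical n_kappa kap -natr1; apply/eqP; ring.
have nE : n%:R = q%:R + 1 :> 'Z_e by rewrite n_kappa kap; ring.
have Zp1 : (1 : 'Z_e) != 0 := oner_neq0 _.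
have Zp2 : (1 + 1 : 'Z_e) != 0.
  have /andP[_] := C_sparse cq.
  rewrite /critical nE -[q.+3]addn3 natrD -subr_eq0.
  have -> // : q%:R + 3%:R - (q%:R + 1) = 1 + 1 :> 'Z_e by ring.
move: res1; rewrite !(wresS n_kappa) res0 => /addrI.
rewrite nE; have -> : q%:R + 1 - (q%:R + 1) = 0 :> 'Z_e by ring.
have -> : q%:R + 1 - q%:R - 1 = 0 :> 'Z_e by ring.
have [tq|tq] := boolP (q.+1 <= m)%N.
  have t1 : target_word q.+1 by rewrite /target_word tq.
  have w1 : w q.+1 = false by apply/negbTE/negP => w1; apply: neq; rewrite w1 t1.
  have qm : q.+1 != m.
    by apply/eqP => qm; move: (Cm); rewrite -qm cq w1 => /(_ isT).
  have t2 : target_word q.+2 by rewrite /target_word; clear -tq qm; lia.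
  rewrite w1 t1 t2; case: ifP => _ /eqP.
    by rewrite eq_sym oppr_eq0 (negbTE Zp1).
  by rewrite -subr_eq0 opprK (negbTE Zp2).
have t1 : target_word q.+1 = false by rewrite /target_word; clear -tq qn'; lia.
have w1 : w q.+1 by apply: contrapT => /negP w1; apply: neq; rewrite t1 (negbTE w1).
have qn2 : q.+2 != n.
  by apply/eqP => qn2; have := C_sparse cq; rewrite qn2 critical_n.
have t2 : target_word q.+2 = false by rewrite /target_word; clear -tq qn2; lia.
rewrite w1 t1 t2; case: ifP => _ /eqP.
  by rewrite eq_sym -subr_eq0 opprK (negbTE Zp2).
by rewrite eq_sym (negbTE Zp1).
Qed.

Lemma isolate_target f : good_supp f -> f target_word != 0 ->
  reach f (delta F target_word).
Proof.
move=> hf ft; pose f1 := Idem (wR target_word) f.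
have ff1 : reach f f1 by apply/reach_e/reach0.
have t1 : target_word m by rewrite /target_word leqnn.
have scale g : reach f g -> g target_word = f target_word ->
    (forall w, w <> target_word -> g w = 0) -> reach f (delta F target_word).
  move=> fg gt g0.
  have -> : delta F target_word = (fun w => (f target_word)^-1 * g w).
    apply: funext => w; have [->|nw] := pselect (w = target_word).
      by rewrite deltaE gt mulVf.
    by rewrite delta_neq // g0 // mulr0.
  exact: reach_scale.
have [cm|cm] := boolP (C m); last first.
  apply: (scale f1) => // [|w nw]; rewrite /f1 /e_op ?eqxx //.
  case: eqP => // eqR; apply/eqP; apply: contraPT nw => /hf gw.
  by apply; apply: target_unique => //; rewrite (negbTE cm).
have m0 := critical_gt0 cm.
have m1n : (m.+1 < n)%N.
  rewrite ltn_neqAle mn andbT; apply/eqP => mn'.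
  by have := C_sparse cm; rewrite mn' critical_n.
have t2 : ~~ target_word m.+1 by rewrite /target_word; lia.
(* At leg, arm the operator [y_{m+1}] reads arm, leg, and [psi_m] reads leg, arm again; on all other
   pairs of letters [y_{m+1}] vanishes, as [m] is critical and [m.+1] is not. *)
have opE g w : Y m.+1 (Psi m g) w = if w m && ~~ w m.+1 then g w else 0.
  have /andP[cm1 _] := C_sparse cm.
  rewrite /y_op /move_op /y_move /= cm (negbTE cm1) /=.
  case: ifP => //= /andP[w1 w2].
  case: m m0 w1 w2 => // p _ w1 w2.
  by rewrite psi_op_down ?swapK ?swap_at_l ?swap_at_r.
apply: (scale (Y m.+1 (Psi m f1))).
- by apply: reach_y; [|apply: reach_psi]; rewrite ?m0 ?mn.
- by rewrite opE t1 t2 /f1 /e_op eqxx.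
move=> w nw; rewrite opE; case: ifP => // wm; rewrite /f1 /e_op.
case: eqP => // eqR; apply/eqP; apply: contraPT nw => /hf gw.
by apply; apply: target_unique.
Qed.

Lemma reach_delta_target f : good_supp f -> (exists w, f w != 0) ->
  reach f (delta F target_word).
Proof.
move=> hf [w fw]; have [g [fg gt]] := reach_target hf fw.
exact: reach_trans fg (isolate_target (reach_good fg hf) gt).
Qed.

End WordModule.

(** * Evaluation of the Specht module on words *)

Section CyclicEvaluation.
Variables (F : fieldType) (T : Type) (A : pzRingType).
Variables (act : A -> (T -> F) -> T -> F) (actP : is_action act).
Variables (rel : A -> Prop) (f0 : T -> F).
Hypothesis rel_f0 : forall x, rel x -> act x f0 = fun=> 0.

Definition cyclic_eval (q : cyclic_module rel) : T -> F := act (repr q) f0.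

Lemma cyclic_evalE x : cyclic_eval (x *: cyclic_gen rel) = act x f0.
Proof.
have [actD actM _ _] := actP.
apply: funext => t; apply/eqP; rewrite -subr_eq0 -(actB actP); apply/eqP.
have: left_ideal_gen rel (repr (x *: cyclic_gen rel) - x).
  by apply/cyclic_projP; rewrite cyclic_projK cyclic_projE.
move: (repr _ - x) => x' h; elim: h t => {x x'} [x /rel_f0-> //||x x' _ hx _ hx'|a x _ hx] t.
- exact: act0 actP _ _.
- by rewrite actD hx hx' addr0.
- have -> : act (a * x) f0 = act a (fun=> 0).
    by rewrite actM; congr act; apply: funext.
  by rewrite (act_zero actP).
Qed.

Lemma cyclic_evalZ a q : cyclic_eval (a *: q) = act a (cyclic_eval q).
Proof.
have [_ actM _ _] := actP.
by rewrite -[q]cyclic_projK cyclic_projE scalerA !cyclic_evalE actM.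
Qed.

Lemma cyclic_evalD q q' t :
  cyclic_eval (q + q') t = cyclic_eval q t + cyclic_eval q' t.
Proof.
have [actD _ _ _] := actP.
rewrite -[q]cyclic_projK -[q']cyclic_projK !cyclic_projE -scalerDl.
by rewrite !cyclic_evalE actD.
Qed.

Lemma cyclic_eval_gen : cyclic_eval (cyclic_gen rel) = f0.
Proof.
have [_ _ act1 _] := actP.
by rewrite -[cyclic_gen rel]scale1r cyclic_evalE act1.
Qed.

End CyclicEvaluation.

Lemma malgC_comm_monomial (K : monomType) (R : comNzRingType) (c : R) (k : K) :
  c%:MP * << k >> = << k >> * c%:MP :> {malg R[K]}.
Proof.
rewrite [LHS]malgM_def [RHS]malgM_def.
by rewrite [LHS]fgmulUU [RHS]fgmulUU mulr1 mul1r mul1m mulm1.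
Qed.

Lemma malgC_monomial (K : monomType) (R : comNzRingType) (c : R) (k : K) :
  << c *g k >> = c%:MP * << k >> :> {malg R[K]}.
Proof. by rewrite [RHS]malgM_def [RHS]fgmulUU mulr1 mul1m. Qed.

Lemma free_klr_ind (F : fieldType) (e n : nat) (P : klr_free F e n -> Prop) :
  (forall c : F, P (c%:MP : {malg F[{fmonom klr_gen e n}]})) ->
  (forall x x', P x -> P x' -> P (x + x')) ->
  (forall x x', P x -> P x' -> P (x * x')) ->
  (forall g, P (free_gen F g)) -> forall x, P x.
Proof.
move=> hC hD hM hg x.
have hU (c : F) (k : {fmonom klr_gen e n}) : P << c *g k >>.
  rewrite malgC_monomial; apply: (hM) => //; case: k => s; elim: s => [|g s ih].
    have -> : FMonom [::] = mone :> {fmonom klr_gen e n}.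
      by apply/eqP; rewrite fmP fm1.
    exact: hC 1.
  have -> : << FMonom (g :: s) >> =
      << fmu g >> * << FMonom s >> :> {malg F[{fmonom klr_gen e n}]}.
    rewrite malgM_def fgmulUU mulr1; congr << _ *g _ >>; apply/eqP.
    by rewrite fmP fmM fmU.
  by apply: (hM); [exact: hg | exact: ih].
rewrite [x]monalgE; elim/big_ind: _ => //.
by have := hC 0; rewrite malgC0E.
Qed.

Lemma free_const_comm (F : fieldType) (e n : nat) (c : F) (x : klr_free F e n) :
  GRing.comm ((c%:MP : {malg F[{fmonom klr_gen e n}]}) : klr_free F e n) x.
Proof.
elim/free_klr_ind: x => [d|x x' h h'|x x' h h'|g].
- have h (a b : F) : (a * b)%:MP = a%:MP * b%:MP :> {malg F[{fmonom klr_gen e n}]}.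
    exact: mpolyCM.
  by rewrite /GRing.comm -[LHS](h c d) -[RHS](h d c) mulrC.
- exact: commrD.
- exact: commrM.
- exact: malgC_comm_monomial.
Qed.

Section HookSpechtModule.
Variables (F : fieldType) (e n m : nat) (kappa : 'Z_e * 'Z_e).
Hypotheses (e_gt2 : (2 < e)%N) (n_kappa : n%:R = kappa.2 - kappa.1 + 1)
  (n_neq0 : n%:R != 0 :> 'Z_e) (n_gt0 : (0 < n)%N) (mn : (m < n)%N).

Local Notation A := (cklr F n kappa).
Local Notation phi := (@free_to_cklr F e n kappa).
Local Notation cst c := (phi (c%:MP : {malg F[{fmonom klr_gen e n}]})).
Local Notation S := (specht F n kappa m.+1).
Local Notation z := (specht_z F n kappa m.+1).
Local Notation act := (@cklr_act F e n kappa).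
Local Notation w0 := (initial_word m.+1).

Let actP : is_action act. Proof. exact: cklr_act_action. Qed.

Let actE x f : act (phi x) f = free_act kappa x f.
Proof. exact: cklr_actE. Qed.

Lemma act_specht_rel x : specht_rel m.+1 x -> act x (delta F w0) = fun=> 0.
Proof.
case=> {x} [|r hr|r hr rm].
- apply: funext => w; have [_ _ act1 _] := actP.
  rewrite (actB actP) act1 /cklr_e actE free_act_e /e_op.
  rewrite -word_res_initial //.
  have [->|ww] := pselect (w = w0); first by rewrite eqxx subrr.
  by rewrite delta_neq // if_same subrr.
- by rewrite /cklr_y actE free_act_y // y_op_initial.
- by rewrite /cklr_psi actE free_act_psi // psi_op_initial //; case/andP: hr.
Qed.

Definition specht_eval (s : S) : word -> F := cyclic_eval act (delta F w0) s.

Lemma specht_evalZ a s : specht_eval (a *: s) = act a (specht_eval s).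
Proof. exact: (cyclic_evalZ actP act_specht_rel). Qed.

Lemma specht_evalD s s' w :
  specht_eval (s + s') w = specht_eval s w + specht_eval s' w.
Proof. exact: (cyclic_evalD actP act_specht_rel). Qed.

Lemma specht_evalB s s' w :
  specht_eval (s - s') w = specht_eval s w - specht_eval s' w.
Proof. by apply/eqP; rewrite eq_sym subr_eq -specht_evalD subrK. Qed.

Lemma specht_eval_z : specht_eval z = delta F w0.
Proof. exact: (cyclic_eval_gen actP act_specht_rel). Qed.

Lemma specht_eval_psi r s : (0 < r < n)%N ->
  specht_eval (cklr_psi kappa r *: s) = @psi_op F e n r (specht_eval s).
Proof. by move=> hr; rewrite specht_evalZ /cklr_psi actE free_act_psi. Qed.

Lemma specht_eval_const c s w : specht_eval (cst c *: s) w = c * specht_eval s w.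
Proof. by rewrite specht_evalZ actE free_actC. Qed.

Lemma specht_eval_std j w s : std n m.+1 (@cklr_psi F e n kappa) z j w s ->
  specht_eval s = delta F w.
Proof.
elim=> {j w s} [|j r w s hr w1 w2 _ ih]; first exact: specht_eval_z.
rewrite specht_eval_psi // ih psi_op_delta //; by case/andP: hr.
Qed.

Let E_E i j : cklr_e F kappa i * cklr_e F kappa j =
  (if i == j then cklr_e F kappa i else 0) :> A.
Proof.
refine (etrans (esym (morph_M2 phi _ _)) (etrans (cklr_relE kappa (klr_ee F i j)) _)).
by case: ifP => // _; exact: rmorph0.
Qed.

Let cst_comm (c : F) x : cst c * phi x = phi x * cst c.
Proof.
refine (etrans (esym (morph_M2 phi _ _)) (etrans _ (morph_M2 phi _ _))).
by rewrite free_const_comm.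
Qed.

Local Notation spannedS :=
  (spanned n m.+1 (@cklr_psi F e n kappa) (fun c => cst c) z).

Lemma specht_spanned (s : S) : spannedS s.
Proof.
have free_spanned x (t : S) : spannedS t -> spannedS (phi x *: t).
  elim/free_klr_ind: x t => [c|x x' h h'|x x' h h'|g] t ht.
  - exact: spannedZ.
  - by rewrite rmorphD scalerDl; apply: spannedD; [apply: h | apply: h'].
  - by rewrite rmorphM -scalerA; apply: h; apply: h'.
  case: g => [i|r|r].
  - exact: (spanned_e mn E_E (@cklr_psi_e F e n kappa)
              (fun c i => cst_comm c (free_e F i)) (specht_z_e F n kappa m.+1)).
  - have -> : free_gen F (GenY e r) = free_y F e n (val r) by rewrite /free_y valK.
    exact: (spanned_y mn (@cklr_psi_e F e n kappa) (@cklr_psi_y F e n kappa)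
              (@cklr_psi_psi F e n kappa) (@cklr_psi_yS F e n kappa)
              (@cklr_yS_psi F e n kappa) (@cklr_psi2 F e n kappa)
              (@cklr_braid F e n kappa)
              (fun c r => cst_comm c (free_y F e n r))
              (fun c r => cst_comm c (free_psi F e n r))
              (specht_z_e F n kappa m.+1) (@specht_z_y F e n kappa m.+1)
              (@specht_z_psi F e n kappa m.+1) (valP r)).
  - have -> : free_gen F (GenPsi e r) = free_psi F e n (val r).
      by rewrite /free_psi valK.
    exact: (spanned_psi mn (@cklr_psi_e F e n kappa) (@cklr_psi_y F e n kappa)
              (@cklr_psi_psi F e n kappa) (@cklr_psi_yS F e n kappa)
              (@cklr_yS_psi F e n kappa) (@cklr_psi2 F e n kappa)
              (@cklr_braid F e n kappa)
              (fun c r => cst_comm c (free_psi F e n r))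
              (specht_z_e F n kappa m.+1) (@specht_z_y F e n kappa m.+1)
              (@specht_z_psi F e n kappa m.+1) (valP r)).
(* Three representatives: from the cyclic module to [cklr], then to [klr], then to the free
   algebra. *)
have -> : s = phi (repr (repr (repr s))) *: z.
  by rewrite /free_to_cklr /= !ring_projK -cyclic_projE cyclic_projK.
exact/free_spanned/spanned_z.
Qed.

Let constD (c d : F) : (c + d)%:MP = c%:MP + d%:MP :> {malg F[{fmonom klr_gen e n}]}.
Proof. exact: monalgUD. Qed.

Let constM (c d : F) : (c * d)%:MP = c%:MP * d%:MP :> {malg F[{fmonom klr_gen e n}]}.
Proof. exact: mpolyCM. Qed.

Let const1 : 1%:MP = 1 :> {malg F[{fmonom klr_gen e n}]}.
Proof. exact: mpolyC1E. Qed.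

Let cstD (c d : F) : cst (c + d) = cst c + cst d.
Proof. by rewrite constD; apply: (rmorphD phi). Qed.

Let cstM (c d : F) : cst (c * d) = cst c * cst d.
Proof. by rewrite constM; apply: (rmorphM phi). Qed.

Let cst1 : cst (1 : F) = 1.
Proof. by rewrite const1; apply: (rmorph1 phi). Qed.

(** The value at a word is the coefficient of its standard vector, since standard vectors evaluate
    to the functions [delta] and span. *)
Lemma specht_eval_inj (s : S) : (forall w, specht_eval s w = 0) -> s = 0.
Proof.
apply: (spanned_eq0 mn (@cklr_psi_psi F e n kappa) cstD cstM cst1 specht_evalD
          specht_eval_const _ (specht_spanned s)).
by move=> j w t ht w'; rewrite (specht_eval_std ht).
Qed.

(** The product [psi_{n-1} ... psi_{m+1}] carries the last leg of the initial word from [m.+1] to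
    [n], one place at a time. *)
Lemma specht_eval_target :
  specht_eval (hook_target F n kappa m) = delta F (target_word n m).
Proof.
rewrite hook_targetE.
suff chain k : (m < k <= n)%N ->
    specht_eval (psi_down F n kappa k m.+1 *: z) =
    delta F (fun j => (j <= m)%N || (j == k)).
  by rewrite chain ?mn ?leqnn.
elim: k => // k ih hk; have [->|km] := eqVneq k m.
  rewrite /psi_down /index_iota subnn big_nil scale1r specht_eval_z.
  by congr delta; apply: funext => j; rewrite /initial_word leq_eqVlt orbC.
have hk' : (m < k)%N by lia.
have -> : psi_down F n kappa k.+1 m.+1 *: z =
    cklr_psi kappa k *: (psi_down F n kappa k m.+1 *: z).
  rewrite scalerA; congr (_ *: _); rewrite /psi_down.
  rewrite /index_iota subSn // -[(k - m.+1).+1]addn1 iotaD subnKC // rev_cat.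
  by rewrite big_cons.
rewrite specht_eval_psi; last by lia.
rewrite ih; last by lia.
rewrite psi_op_delta; [|by lia|by rewrite eqxx orbT|by lia].
congr delta; apply: funext => j; rewrite /swap.
by have [->|jk] := eqVneq j k; [lia | have [->|jk1] := eqVneq j k.+1; lia].
Qed.

Lemma act_good x f : good_supp n m f -> good_supp n m (act x f).
Proof.
have free_good (y : klr_free F e n) g :
    good_supp n m g -> good_supp n m (free_act kappa y g).
  elim/free_klr_ind: y g => [c|y y' h h'|y y' h h'|[i|r|r]] g hg.
  - by move=> w; rewrite free_actC mulf_eq0 negb_or => /andP[_]; apply: hg.
  - move=> w; rewrite free_actD => hw.
    have [e0|] := eqVneq (free_act kappa y g w) 0; last exact: h.
    by apply: (h' _ hg); move: hw; rewrite e0 add0r.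
  - by rewrite free_actM; apply: h; apply: h'.
  - by rewrite free_act_gen; apply: good_e.
  - by rewrite free_act_gen; apply: (good_y e_gt2 n_neq0 mn).
  - by rewrite free_act_gen; apply: (good_psi e_gt2 n_neq0 mn (valP r)).
have -> : x = phi (repr (repr x)) by rewrite /free_to_cklr /= !ring_projK.
by rewrite actE; apply: free_good.
Qed.

Lemma reach_act f g : reach n kappa f g -> exists x, act x f = g.
Proof.
have [_ actM act1 _] := actP.
elim=> {g} [|r g hr _ [x <-]|r g hr _ [x <-]|i g _ [x <-]|c g _ [x <-]].
- by exists 1; rewrite act1.
- by exists (phi (free_psi F e n r) * x); rewrite actM actE free_act_psi.
- by exists (phi (free_y F e n r) * x); rewrite actM actE free_act_y.
- by exists (phi (free_e F i) * x); rewrite actM actE free_act_e.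
- exists (cst c * x); rewrite actM actE; apply: funext => w.
  by rewrite free_actC.
Qed.

Lemma target_good : good n m (target_word n m).
Proof.
split; rewrite /target_word ?eqxx ?orbT //; first by move=> k; lia.
have [n' n'E] : exists n', n = n'.+1 by exists n.-1; lia.
rewrite n'E legsS eqxx orbT addn1; congr _.+1.
transitivity (legs (initial_word m) n'); last by rewrite legs_initial; lia.
by apply: eq_big_nat => j jn; congr nat_of_bool; rewrite /initial_word; lia.
Qed.

Lemma specht_eval_neq0 (s : S) : s != 0 -> exists w, specht_eval s w != 0.
Proof.
move=> s0; apply: contrapT => no; case/eqP: s0; apply: specht_eval_inj => w.
by apply/eqP/negPn/negP => h; apply: no; exists w.
Qed.

(** A nonzero [a *: t] evaluates to a nonzero function with good support, from which the target
    function is reached; injectivity of the evaluation lifts this back to the Specht module. *)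
Lemma orbit_inverse (t : S) (a : A) : specht_eval t = delta F (target_word n m) ->
  a *: t != 0 -> exists b, b *: (a *: t) = t.
Proof.
move=> tE /specht_eval_neq0 ne.
have hg : good_supp n m (specht_eval (a *: t)).
  rewrite specht_evalZ tE; apply: act_good => w.
  have [->|nw] := pselect (w = target_word n m); first by move=> _; apply: target_good.
  by rewrite delta_neq // eqxx.
have [b hb] := reach_act (reach_delta_target e_gt2 n_kappa n_neq0 mn hg ne).
exists b; apply/eqP; rewrite -subr_eq0; apply/eqP/specht_eval_inj => w.
by rewrite specht_evalB specht_evalZ hb tE subrr.
Qed.

Lemma specht_eval_delta_neq0 (t : S) w : specht_eval t = delta F w -> t != 0.
Proof.
move=> tE; apply/eqP => t0; have := congr1 (fun f => f w) tE.
rewrite t0 deltaE -[0](scale0r t) specht_evalZ (act0 actP).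
by move/eqP; rewrite eq_sym oner_eq0.
Qed.

End HookSpechtModule.

(** A nonzero submodule contains some nonzero [a *: v], hence [v], hence the whole orbit of [v]. The
    hypotheses live in [V], so that the subtype [im f] is handled only here. *)
Lemma im_irreducible (A : pzRingType) (U V : lmodType A) (f : {linear U -> V}) v :
  (exists u, f u = v) -> v != 0 -> (forall u, exists a, f u = a *: v) ->
  (forall a, a *: v != 0 -> exists b, b *: (a *: v) = v) -> irreducible (im f).
Proof.
move=> v_im v0 orbit inv_orbit; split.
  have vI : v \in im_pred f by apply/asboolP.
  by exists (Sub v vI); apply: contra_neq v0 => /(congr1 val); rewrite SubK linear0.
move=> W; have [W0|W0] := pselect (forall x, x \in W -> x = 0); [by left|right=> u].
have [x [xW x0]] : exists x, x \in W /\ x != 0.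
  apply: contrapT => no; apply: W0 => x xW; apply/eqP/negPn/negP => x0.
  by apply: no; exists x.
have val_orbit (y : im f) : exists a, val y = a *: v.
  by have /asboolP[s <-] := valP y; apply: orbit.
have [a xa] := val_orbit x; have [c uc] := val_orbit u.
have [|b bav] := inv_orbit a.
  by rewrite -xa; apply: contra_neq x0 => x0; apply: val_inj; rewrite x0 linear0.
have -> : u = (c * b) *: x.
  by apply: val_inj; rewrite linearZ /= xa uc -scalerA bav.
exact: rpredZ.
Qed.

Theorem theorem6p10 (F : fieldType) (e n : nat) (kappa : 'Z_e * 'Z_e)
    (e_ge3 : (3 <= e)%N) (n_ge1 : (1 <= n)%N)
    (kappa_neq : kappa.2 <> kappa.1 - 1)
    (n_kappa : n%:R = kappa.2 - kappa.1 + 1)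
    (m : nat) (m_lt_n : (m < n)%N) :
  irreducible (im (hook_hom F e_ge3 m_lt_n n_kappa)).
Proof.
(* [n = 0] in [Z/e] would mean [kappa.2 = kappa.1 - 1], the excluded case. *)
have n_neq0 : n%:R != 0 :> 'Z_e.
  apply/eqP => n0; apply: kappa_neq; apply/eqP.
  by rewrite -subr_eq0 opprB addrA addrAC -n_kappa n0.
have fz := hook_homE F e_ge3 m_lt_n n_kappa.
have tE := specht_eval_target F e_ge3 n_kappa n_neq0 n_ge1 m_lt_n.
apply: (@im_irreducible _ _ _ _ (hook_target F n kappa m)).
- by exists (specht_z F n kappa m).
- exact: specht_eval_delta_neq0 tE.
- move=> u; exists (repr u); rewrite -fz -linearZ; congr (hook_hom _ _ _ _ _).
  by rewrite -cyclic_projE cyclic_projK.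
- by move=> a; apply: orbit_inverse tE.
Qed.
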